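(* Let $\boldsymbol{A}\in\mathbb{DQ}^{m\times n}$, $\boldsymbol{B}\in\mathbb{DQ}^{n\times p}$, $\boldsymbol{C}\in\mathbb{DQ}^{p\times q}$, and let $r=\mathrm{Arank}(\boldsymbol{ABC})$. Then there exist unitary matrices $\boldsymbol{U}\in\mathbb{DQ}^{m\times m}$, $\boldsymbol{V}\in\mathbb{DQ}^{q\times q}$, nonsingular matrices $\boldsymbol{P}\in\mathbb{DQ}^{n\times n}$, $\boldsymbol{Q}\in\mathbb{DQ}^{p\times p}$, and nonnegative integers $i,j,k,s,t$ such that $$\boldsymbol{U}^{*}\boldsymbol{A}\boldsymbol{P}=\begin{pmatrix}I_i&0\\0&\mathbf A_{22}\epsilon\end{pmatrix},\qquad \boldsymbol{P}^{-1}\boldsymbol{B}\boldsymbol{Q}=\begin{pmatrix}I_j&0&0\\0&\hat{\mathbf B}_{12}\epsilon&\hat{\mathbf B}_{13}\epsilon\\0&I_k&\mathbf B_{23}\epsilon\\0&0&\hat{\mathbf B}_{23}\epsilon\end{pmatrix},$$ $$\boldsymbol{Q}^{-1}\boldsymbol{C}\boldsymbol{V}=\begin{pmatrix}\Sigma&0&0&0\\0&\hat{\mathbf C}_{12}\epsilon&\hat{\mathbf C}_{13}\epsilon&\hat{\mathbf C}_{14}\epsilon\\ \mathbf C_{21}\epsilon&I_s&0&\mathbf C_{24}\epsilon\\0&0&0&\hat{\mathbf C}_{24}\epsilon\\ \mathbf C_{31}\epsilon&0&I_t&\mathbf C_{34}\epsilon\\0&0&0&\hat{\mathbf C}_{34}\epsilon\end{pmatrix},$$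 where: the matrix $\boldsymbol U^*\boldsymbol{AP}$ has block row heights $i,m-i$ and block column widths $i,n-i$; $\boldsymbol P^{-1}\boldsymbol{BQ}$ has block row heights $j,\ i-j,\ k,\ n-i-k$ and block column widths $j,\ k,\ p-j-k$; $\boldsymbol Q^{-1}\boldsymbol{CV}$ has block row heights $r,\ j-r,\ s,\ k-s,\ t,\ p-j-k-t$ and block column widths $r,\ s,\ t,\ q-r-s-t$; the matrices $\mathbf A_{22},\hat{\mathbf B}_{12},\hat{\mathbf B}_{13},\mathbf B_{23},\hat{\mathbf B}_{23},\hat{\mathbf C}_{12},\hat{\mathbf C}_{13},\hat{\mathbf C}_{14},\mathbf C_{21},\mathbf C_{24},\hat{\mathbf C}_{24},\mathbf C_{31},\mathbf C_{34},\hat{\mathbf C}_{34}$ are quaternion matrices; and $\Sigma=\mathrm{diag}(\delta_1,\dots,\delta_r)$, where $\delta_1\ge\cdots\ge\delta_r>0$ are the appreciable singular values (dual numbers) of the product $\boldsymbol{ABC}$.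
   Context: $\mathbb{R},\mathbb{D},\mathbb{Q},\mathbb{DQ}$ denote the real numbers, dual numbers, (Hamilton) quaternions and dual quaternions. A dual number is $a+b\epsilon$ with $a,b\in\mathbb{R}$, $\epsilon\neq0$, $\epsilon^2=0$; a dual quaternion is $\boldsymbol q=\mathbf q_{st}+\mathbf q_{in}\epsilon$ with $\mathbf q_{st},\mathbf q_{in}\in\mathbb{Q}$, where $\epsilon^2=0$ and $\epsilon$ commutes with quaternions. An element is appreciable if its standard part (the coefficient without $\epsilon$) is nonzero, and infinitesimal otherwise. The conjugate is $\boldsymbol q^*=\mathbf q_{st}^*+\mathbf q_{in}^*\epsilon$. Dual numbers are totally ordered lexicographically: $p_{st}+p_{in}\epsilon>q_{st}+q_{in}\epsilon$ iff $p_{st}>q_{st}$, or $p_{st}=q_{st}$ and $p_{in}>q_{in}$. $\mathbb{DQ}^{m\times n}$ (resp. $\mathbb{Q}^{m\times n}$) is the set of $m\times n$ matrices over the dual quaternions (resp. quaternions); $\boldsymbol A^*=(\boldsymbol a_{ji}^* )$ is the conjugate transpose. A square matrix $\boldsymbol U$ is unitary if $\boldsymbol U^*\boldsymbol U=\boldsymbol U\boldsymbol U^*=I$, and nonsingular if it has a two-sided inverse. Block rows and columns may be empty; all block sizes appearing are required to be nonnegative. Singular values and appreciable rank (known dual quaternion SVD): for every $\boldsymbol M\in\mathbb{DQ}^{m\times n}$ there are unitary dual quaternion matrices $\boldsymbol U,\boldsymbol V$ with $\boldsymbol U^*\boldsymbol M\boldsymbol V=\begin{pmatrix}\Sigma_\tau&0\\0&0\end{pmatrix}$,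 $\Sigma_\tau=\mathrm{diag}(\mu_1,\dots,\mu_\rho,\dots,\mu_\tau)$, $\rho\le\tau\le\min\{m,n\}$, where $\mu_1\ge\cdots\ge\mu_\rho$ are positive appreciable dual numbers and $\mu_{\rho+1}\ge\cdots\ge\mu_\tau$ are positive infinitesimal dual numbers; $\Sigma_\tau$ is unique. The $\mu$'s are the (nonzero) singular values of $\boldsymbol M$, $\mu_1,\dots,\mu_\rho$ its appreciable singular values, and $\mathrm{Arank}(\boldsymbol M)=\rho$. *)

(* Defs.v *)
From HB Require Import structures.
From mathcomp Require Import all_boot all_order all_algebra.
From mathcomp Require Import ring.
From mathcomp Require Import classical_sets reals.

Set Implicit Arguments.
Unset Strict Implicit.
Unset Printing Implicit Defensive.

Import Order.TTheory GRing.Theory Num.Theory.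

Local Open Scope ring_scope.

Record quat (R : Type) : Type := Quat { qre : R; qim : R; qjm : R; qkm : R }.

Definition quat_to_prod (R : Type) (x : quat R) := (qre x, qim x, qjm x, qkm x).
Definition prod_to_quat (R : Type) (t : R * R * R * R) : quat R :=
  let: (a, b, c, d) := t in Quat a b c d.

Lemma quat_to_prodK (R : Type) : cancel (@quat_to_prod R) (@prod_to_quat R).
Proof. by case. Qed.

HB.instance Definition _ (R : choiceType) :=
  Choice.copy (quat R) (can_type (@quat_to_prodK R)).

Definition quat_add (R : comNzRingType) (x y : quat R) : quat R :=
  Quat (qre x + qre y) (qim x + qim y) (qjm x + qjm y) (qkm x + qkm y).
Definition quat_opp (R : comNzRingType) (x : quat R) : quat R :=
  Quat (- qre x) (- qim x) (- qjm x) (- qkm x).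
Definition quat_mul (R : comNzRingType) (x y : quat R) : quat R :=
  Quat (qre x * qre y - qim x * qim y - qjm x * qjm y - qkm x * qkm y)
       (qre x * qim y + qim x * qre y + qjm x * qkm y - qkm x * qjm y)
       (qre x * qjm y - qim x * qkm y + qjm x * qre y + qkm x * qim y)
       (qre x * qkm y + qim x * qjm y - qjm x * qim y + qkm x * qre y).

Definition real_quat (R : comNzRingType) (a : R) : quat R := Quat a 0 0 0.

Lemma quat_addA (R : comNzRingType) : associative (@quat_add R).
Proof. by move=> [? ? ? ?] [? ? ? ?] [? ? ? ?]; congr Quat; rewrite /= addrA. Qed.
Lemma quat_addC (R : comNzRingType) : commutative (@quat_add R).
Proof. by move=> [? ? ? ?] [? ? ? ?]; congr Quat; rewrite /= addrC. Qed.
Lemma quat_add0 (R : comNzRingType) : left_id (real_quat 0) (@quat_add R).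
Proof. by move=> [? ? ? ?]; congr Quat; rewrite /= add0r. Qed.
Lemma quat_addN (R : comNzRingType) :
  left_inverse (real_quat 0) (@quat_opp R) (@quat_add R).
Proof. by move=> [? ? ? ?]; congr Quat; rewrite /= addNr. Qed.

HB.instance Definition _ (R : comNzRingType) := GRing.isZmodule.Build (quat R)
  (@quat_addA R) (@quat_addC R) (@quat_add0 R) (@quat_addN R).

Lemma quat_mulA (R : comNzRingType) : associative (@quat_mul R).
Proof. by move=> [? ? ? ?] [? ? ? ?] [? ? ? ?]; congr Quat; rewrite /=; ring. Qed.
Lemma quat_mul1l (R : comNzRingType) : left_id (real_quat 1) (@quat_mul R).
Proof. by move=> [? ? ? ?]; congr Quat; rewrite /=; ring. Qed.
Lemma quat_mul1r (R : comNzRingType) : right_id (real_quat 1) (@quat_mul R).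
Proof. by move=> [? ? ? ?]; congr Quat; rewrite /=; ring. Qed.
Lemma quat_mulDl (R : comNzRingType) : left_distributive (@quat_mul R) +%R.
Proof. by move=> [? ? ? ?] [? ? ? ?] [? ? ? ?]; congr Quat; rewrite /=; ring. Qed.
Lemma quat_mulDr (R : comNzRingType) : right_distributive (@quat_mul R) +%R.
Proof. by move=> [? ? ? ?] [? ? ? ?] [? ? ? ?]; congr Quat; rewrite /=; ring. Qed.
Lemma quat_1neq0 (R : comNzRingType) : real_quat (1 : R) != 0.
Proof. by apply/eqP => -[] /eqP; rewrite oner_eq0. Qed.

HB.instance Definition _ (R : comNzRingType) :=
  GRing.Zmodule_isNzRing.Build (quat R) (@quat_mulA R) (@quat_mul1l R)
    (@quat_mul1r R) (@quat_mulDl R) (@quat_mulDr R) (@quat_1neq0 R).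

Definition quat_conj (R : comNzRingType) (x : quat R) : quat R :=
  Quat (qre x) (- qim x) (- qjm x) (- qkm x).

(* Dual a b stands for a + b eps, where eps ^+ 2 = 0 and eps is central. The
   coefficient ring T need not be commutative: dualnum R is the ring of dual
   numbers and dualnum (quat R) the ring of dual quaternions. *)
Record dualnum (T : Type) : Type := Dual { stpart : T; inpart : T }.

Definition dual_to_prod (T : Type) (x : dualnum T) := (stpart x, inpart x).
Definition prod_to_dual (T : Type) (t : T * T) : dualnum T := Dual t.1 t.2.

Lemma dual_to_prodK (T : Type) : cancel (@dual_to_prod T) (@prod_to_dual T).
Proof. by case. Qed.

HB.instance Definition _ (T : choiceType) :=
  Choice.copy (dualnum T) (can_type (@dual_to_prodK T)).

Definition dual_add (T : nzRingType) (x y : dualnum T) : dualnum T :=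
  Dual (stpart x + stpart y) (inpart x + inpart y).
Definition dual_opp (T : nzRingType) (x : dualnum T) : dualnum T :=
  Dual (- stpart x) (- inpart x).
Definition dual_mul (T : nzRingType) (x y : dualnum T) : dualnum T :=
  Dual (stpart x * stpart y) (stpart x * inpart y + inpart x * stpart y).

Lemma dual_addA (T : nzRingType) : associative (@dual_add T).
Proof. by move=> [? ?] [? ?] [? ?]; congr Dual; rewrite /= addrA. Qed.
Lemma dual_addC (T : nzRingType) : commutative (@dual_add T).
Proof. by move=> [? ?] [? ?]; congr Dual; rewrite /= addrC. Qed.
Lemma dual_add0 (T : nzRingType) : left_id (Dual 0 0) (@dual_add T).
Proof. by move=> [? ?]; congr Dual; rewrite /= add0r. Qed.
Lemma dual_addN (T : nzRingType) :
  left_inverse (Dual 0 0) (@dual_opp T) (@dual_add T).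
Proof. by move=> [? ?]; congr Dual; rewrite /= addNr. Qed.

HB.instance Definition _ (T : nzRingType) := GRing.isZmodule.Build (dualnum T)
  (@dual_addA T) (@dual_addC T) (@dual_add0 T) (@dual_addN T).

Lemma dual_mulA (T : nzRingType) : associative (@dual_mul T).
Proof.
by move=> [? ?] [? ?] [? ?]; congr Dual; rewrite /= ?mulrDl ?mulrDr ?mulrA ?addrA.
Qed.
Lemma dual_mul1l (T : nzRingType) : left_id (Dual 1 0) (@dual_mul T).
Proof. by move=> [? ?]; congr Dual; rewrite /= !mul1r ?mul0r ?addr0. Qed.
Lemma dual_mul1r (T : nzRingType) : right_id (Dual 1 0) (@dual_mul T).
Proof. by move=> [? ?]; congr Dual; rewrite /= !mulr1 ?mulr0 ?add0r. Qed.
Lemma dual_mulDl (T : nzRingType) : left_distributive (@dual_mul T) +%R.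
Proof.
by move=> [? ?] [? ?] [? ?]; congr Dual; rewrite /= !mulrDl // addrACA.
Qed.
Lemma dual_mulDr (T : nzRingType) : right_distributive (@dual_mul T) +%R.
Proof.
by move=> [? ?] [? ?] [? ?]; congr Dual; rewrite /= !mulrDr // addrACA.
Qed.
Lemma dual_1neq0 (T : nzRingType) : Dual (1 : T) 0 != 0.
Proof. by apply/eqP => -[] /eqP; rewrite oner_eq0. Qed.

HB.instance Definition _ (T : nzRingType) :=
  GRing.Zmodule_isNzRing.Build (dualnum T) (@dual_mulA T) (@dual_mul1l T)
    (@dual_mul1r T) (@dual_mulDl T) (@dual_mulDr T) (@dual_1neq0 T).

Definition appreciable (T : nzRingType) (x : dualnum T) : bool := stpart x != 0.
Definition infinitesimal (T : nzRingType) (x : dualnum T) : bool :=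
  stpart x == 0.

Definition dual_gt (R : realType) (x y : dualnum R) : bool :=
  (stpart x > stpart y) || (stpart x == stpart y) && (inpart x > inpart y).
Definition dual_ge (R : realType) (x y : dualnum R) : bool :=
  (x == y) || dual_gt x y.

Notation dualquat R := (dualnum (quat R)).

Definition dq_conj (R : comNzRingType) (x : dualquat R) : dualquat R :=
  Dual (quat_conj (stpart x)) (quat_conj (inpart x)).

Definition dq_of_dual (R : comNzRingType) (x : dualnum R) : dualquat R :=
  Dual (real_quat (stpart x)) (real_quat (inpart x)).

Definition ctmx (R : comNzRingType) (m n : nat) (A : 'M[dualquat R]_(m, n)) :
  'M[dualquat R]_(n, m) := \matrix_(a, b) dq_conj (A b a).

Definition epsmx (R : comNzRingType) (m n : nat) (A : 'M[quat R]_(m, n)) :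
  'M[dualquat R]_(m, n) := map_mx (fun x => Dual 0 x) A.

Definition unitary_dq (R : comNzRingType) (n : nat)
    (U : 'M[dualquat R]_n) : Prop :=
  ctmx U *m U = 1%:M /\ U *m ctmx U = 1%:M.

(* invmx is only available over commutative rings, so the inverse is handled
   as a second matrix; nonsingularity of P is the existence of such a P'. *)
Definition is_inverse (T : nzRingType) (n : nat) (P P' : 'M[T]_n) : Prop :=
  P *m P' = 1%:M /\ P' *m P = 1%:M.

(* Equality of matrices whose dimensions agree only propositionally, such as a
   matrix of height m and a block matrix of height i + (m - i). *)
Definition cast_eq_mx (T : Type) (m n m' n' : nat)
    (A : 'M[T]_(m, n)) (B : 'M[T]_(m', n')) : Prop :=
  exists e : (m' = m) * (n' = n), A = castmx e B.

Definition sigma_mx (R : comNzRingType) (s : seq (dualnum R)) :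
  'M[dualquat R]_(size s) := diag_mx (\row_a dq_of_dual (nth 0 s a)).

(* ap lists the appreciable singular values mu_1 >= ... >= mu_rho, and im the
   infinitesimal nonzero ones mu_(rho+1) >= ... >= mu_tau. *)
Definition is_singular_values (R : realType) (m n : nat)
    (M : 'M[dualquat R]_(m, n)) (ap im : seq (dualnum R)) : Prop :=
  let tau := size (ap ++ im) in
  [/\ all (fun x => appreciable x && dual_gt x 0) ap && sorted (@dual_ge R) ap,
      all (fun x => infinitesimal x && dual_gt x 0) im
        && sorted (@dual_ge R) im,
      (tau <= minn m n)%N
    & exists (U : 'M[dualquat R]_m) (V : 'M[dualquat R]_n),
      [/\ unitary_dq U, unitary_dq V &
          cast_eq_mx (ctmx U *m M *m V)
                (block_mx (sigma_mx (ap ++ im)) 0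
                          0                     (0 : 'M_(m - tau, n - tau)))]].

(* By the singular value decomposition of dual quaternion matrices, exactly one
   pair satisfies is_singular_values M; the default value is never used. *)
Definition singular_values (R : realType) (m n : nat)
    (M : 'M[dualquat R]_(m, n)) : seq (dualnum R) * seq (dualnum R) :=
  xget ([::], [::]) [set s | is_singular_values M s.1 s.2]%classic.

Definition appreciable_singular_values (R : realType) (m n : nat)
    (M : 'M[dualquat R]_(m, n)) : seq (dualnum R) := (singular_values M).1.

Definition Arank (R : realType) (m n : nat) (M : 'M[dualquat R]_(m, n)) : nat :=
  size (appreciable_singular_values M).

(* Main.v *)
Require Import Defs.
From HB Require Import structures.
From mathcomp Require Import all_boot all_order all_algebra.
From mathcomp Require Import ring lra.
From mathcomp Require Import complex spectral.
From mathcomp Require Import classical_sets reals.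

Set Implicit Arguments.
Unset Strict Implicit.
Unset Printing Implicit Defensive.

Import Order.TTheory GRing.Theory Num.Theory.

Local Open Scope ring_scope.

(** Every dual quaternion matrix has an SVD.  A real symmetric matrix has a real
    eigenvector, hence so does a Hermitian quaternion matrix [G], seen as a real
    symmetric matrix of four times its size; peeling off eigenvectors diagonalises
    [G].  First-order perturbation theory then yields a dual eigenvector of
    [M^* M] with appreciable eigenvalue [mu^2], and completing [v] and [u = M v / mu]
    to unitary matrices splits off the singular value [mu].

    For the product, start from the SVD of [A B C], so that, writing [A] and [C] for
    [U^* A] and [C V], we have [A B C = diag(Sigma, E)] with [E] infinitesimal.  With
    [A1] the first [r] rows of [A] and [C1] the first [r] columns of [C], the columns
    of [Y = C1 Sigma^-1] and [X = B Y] satisfy [A1 X = 1] and [(A1 B) Y = 1], so they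
    extend to bases in which [A = diag(1, A')], [B = diag(1, B')] and
    [C = diag(Sigma, C')], where [A' B' C'] is infinitesimal.  Starting from this SVD
    makes the uniqueness of the singular values unnecessary.  The standard parts of
    [A'], [B'], [C'] are brought to normal form by successive rank decompositions,
    and the infinitesimal parts are cleared by factors [1 + eps K], of which only the
    one acting on the left of [A'] has to be unitary, that is [K^* = - K]. *)

(** * Matrices over a ring with involution *)

(** One theory of adjoints and unitarity serves both the quaternions and the dual quaternions.
    Neither ring is commutative, hence the reversal of products in [invoM]. *)
Record involution (T : nzRingType) := Involution {
  inv_fun :> T -> T;
  invoD : {morph inv_fun : x y / x + y};
  invoM : forall x y, inv_fun (x * y) = inv_fun y * inv_fun x;
  invoK : involutive inv_fun }.

Section Star.
Variables (T : nzRingType) (f : involution T).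

Lemma invo0 : f 0 = 0.
Proof. by apply: (addrI (f 0)); rewrite -invoD !addr0. Qed.

Lemma invo1 : f 1 = 1.
Proof. by rewrite -[LHS]mul1r -{1}[1](invoK f) -invoM mul1r invoK. Qed.

Lemma invoN x : f (- x) = - f x.
Proof. by apply/eqP; rewrite -addr_eq0 -invoD addNr invo0. Qed.

Lemma invo_sum (I : Type) (r : seq I) (P : pred I) (F : I -> T) :
  f (\sum_(i <- r | P i) F i) = \sum_(i <- r | P i) f (F i).
Proof. exact: (big_morph f (@invoD _ f) invo0). Qed.

Definition star m n (A : 'M[T]_(m, n)) : 'M[T]_(n, m) := \matrix_(a, b) f (A b a).

Lemma starE m n (A : 'M[T]_(m, n)) a b : star A a b = f (A b a).
Proof. by rewrite mxE. Qed.

Lemma starK m n : cancel (@star m n) (@star n m).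
Proof. by move=> A; apply/matrixP => a b; rewrite !starE invoK. Qed.

Lemma star0 m n : star (0 : 'M_(m, n)) = 0.
Proof. by apply/matrixP => a b; rewrite !mxE invo0. Qed.

Lemma starD m n (A B : 'M_(m, n)) : star (A + B) = star A + star B.
Proof. by apply/matrixP => a b; rewrite !mxE invoD. Qed.

Lemma starN m n (A : 'M_(m, n)) : star (- A) = - star A.
Proof. by apply/matrixP => a b; rewrite !mxE invoN. Qed.

Lemma starM m n p (A : 'M_(m, n)) (B : 'M_(n, p)) :
  star (A *m B) = star B *m star A.
Proof.
apply/matrixP => a b; rewrite !mxE invo_sum; apply: eq_bigr => c _.
by rewrite !mxE invoM.
Qed.

Lemma star1 n : star (1%:M : 'M_n) = 1%:M.
Proof.
apply/matrixP => a b; rewrite !mxE eq_sym.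
by case: eqP => _; rewrite ?invo1 ?invo0.
Qed.

Lemma star_row m n1 n2 (A : 'M_(m, n1)) (B : 'M_(m, n2)) :
  star (row_mx A B) = col_mx (star A) (star B).
Proof.
by apply/matrixP => a b; rewrite !mxE; case: (split a) => c; rewrite mxE.
Qed.

Lemma star_col m1 m2 n (A : 'M_(m1, n)) (B : 'M_(m2, n)) :
  star (col_mx A B) = row_mx (star A) (star B).
Proof. by rewrite -[RHS]starK star_row !starK. Qed.

Lemma star_block m1 m2 n1 n2 (A : 'M_(m1, n1)) (B : 'M_(m1, n2))
    (C : 'M_(m2, n1)) (D : 'M_(m2, n2)) :
  star (block_mx A B C D) = block_mx (star A) (star C) (star B) (star D).
Proof. by rewrite block_mxEv star_col !star_row block_mxEh. Qed.

Definition unitary n (U : 'M[T]_n) := star U *m U = 1%:M /\ U *m star U = 1%:M.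

Lemma unitary1 n : unitary (1%:M : 'M_n).
Proof. by rewrite /unitary star1 mulmx1. Qed.

Lemma unitaryM n (U V : 'M_n) : unitary U -> unitary V -> unitary (U *m V).
Proof.
move=> [U1 U2] [V1 V2]; rewrite /unitary starM; split.
  by rewrite mulmxA -(mulmxA (star V)) U1 mulmx1.
by rewrite mulmxA -(mulmxA U) V2 mulmx1.
Qed.

Lemma unitary_block m n (U : 'M_m) (V : 'M_n) :
  unitary U -> unitary V -> unitary (block_mx U 0 0 V).
Proof.
move=> [U1 U2] [V1 V2]; rewrite /unitary star_block !star0 !mulmx_block.
by rewrite !mul0mx !mulmx0 !addr0 !add0r U1 U2 V1 V2 -scalar_mx_block.
Qed.
End Star.

(** Eigenvalues and singular values are scalars of this kind: they move freely through
    noncommutative matrix products and through adjoints. *)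
Definition selfadjoint_central (T : nzRingType) (f : involution T) (c : T) :=
  (forall x, c * x = x * c) /\ f c = c.

Section CentralScaling.
Variables (T : nzRingType) (f : involution T) (c : T).
Hypothesis cP : selfadjoint_central f c.

Lemma scale_mulmxr m n p (A : 'M_(m, n)) (B : 'M_(n, p)) :
  A *m (c *: B) = c *: (A *m B).
Proof.
apply/matrixP => a b; rewrite !mxE mulr_sumr; apply: eq_bigr => k _.
by rewrite mxE !mulrA cP.1.
Qed.

Lemma starZ m n (A : 'M_(m, n)) : star f (c *: A) = c *: star f A.
Proof. by apply/matrixP => a b; rewrite !mxE invoM cP.2 cP.1. Qed.
End CentralScaling.

(** * Quaternions and dual quaternions *)

Section Quaternions.
Variable R : comNzRingType.

Lemma quat_conjD : {morph @quat_conj R : x y / x + y}.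
Proof. by move=> [????] [????]; congr Quat; rewrite /= ?opprD. Qed.

Lemma quat_conjM (x y : quat R) :
  quat_conj (x * y) = quat_conj y * quat_conj x.
Proof. by case: x y => [????] [????]; congr Quat; rewrite /=; ring. Qed.

Lemma quat_conjK : involutive (@quat_conj R).
Proof. by case=> *; rewrite /quat_conj /= !opprK. Qed.

Definition quat_involution := Involution quat_conjD quat_conjM quat_conjK.

Lemma dq_conjD : {morph @dq_conj R : x y / x + y}.
Proof. by move=> [??] [??]; congr Dual; rewrite /= quat_conjD. Qed.

Lemma dq_conjM (x y : dualquat R) : dq_conj (x * y) = dq_conj y * dq_conj x.
Proof.
by case: x y => [??] [??]; congr Dual;
  rewrite /= ?quat_conjD !quat_conjM // addrC.
Qed.

Lemma dq_conjK : involutive (@dq_conj R).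
Proof. by case=> *; rewrite /dq_conj /= !quat_conjK. Qed.

Definition dq_involution := Involution dq_conjD dq_conjM dq_conjK.

Lemma real_quatD : {morph @real_quat R : x y / x + y}.
Proof. by move=> x y; congr Quat; rewrite /= ?addr0. Qed.

Lemma real_quatM : {morph @real_quat R : x y / x * y}.
Proof. by move=> x y; congr Quat; rewrite /=; ring. Qed.

Lemma real_quat_inj : injective (@real_quat R).
Proof. by move=> x y []. Qed.

Lemma real_quatP a : selfadjoint_central quat_involution (real_quat a).
Proof.
split=> [[????]|]; first by congr Quat; rewrite /=; ring.
by congr Quat; rewrite /= oppr0.
Qed.

Lemma dq_of_dualM : {morph @dq_of_dual R : x y / x * y}.
Proof. by move=> x y; congr Dual; rewrite /= ?real_quatD !real_quatM. Qed.

Lemma dq_of_dualP a : selfadjoint_central dq_involution (dq_of_dual a).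
Proof.
split=> [[x y]|]; last by congr Dual; apply: (real_quatP _).2.
by congr Dual; rewrite /= !(real_quatP (stpart a)).1 ?(real_quatP (inpart a)).1 // addrC.
Qed.

Definition qnorm2 (x : quat R) := qre x ^+ 2 + qim x ^+ 2 + qjm x ^+ 2 + qkm x ^+ 2.

Lemma conj_mulq x : quat_conj x * x = real_quat (qnorm2 x).
Proof. by case: x => *; rewrite /qnorm2; congr Quat; rewrite /=; ring. Qed.

Lemma mulq_conj x : x * quat_conj x = real_quat (qnorm2 x).
Proof. by case: x => *; rewrite /qnorm2; congr Quat; rewrite /=; ring. Qed.
End Quaternions.

Lemma quat_eta (R : Type) (x : quat R) : x = Quat (qre x) (qim x) (qjm x) (qkm x).
Proof. by case: x. Qed.

Notation qstar := (star (quat_involution _)).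
Notation dqstar := (star (dq_involution _)).
Notation qunitary := (unitary (quat_involution _)).
Notation dqunitary := (unitary (dq_involution _)).

(** * Standard and infinitesimal parts of matrices over dual numbers *)

Section DualMatrices.
Variable T : nzRingType.
Implicit Types m n p : nat.

Definition dmx m n (A B : 'M[T]_(m, n)) : 'M[dualnum T]_(m, n) :=
  \matrix_(a, b) Dual (A a b) (B a b).

Definition stmx m n (A : 'M[dualnum T]_(m, n)) := map_mx (@stpart T) A.
Definition inmx m n (A : 'M[dualnum T]_(m, n)) := map_mx (@inpart T) A.

Lemma dmx_eta m n (A : 'M_(m, n)) : dmx (stmx A) (inmx A) = A.
Proof. by apply/matrixP => a b; rewrite !mxE; case: (A a b). Qed.

Lemma stmx_dmx m n (A B : 'M_(m, n)) : stmx (dmx A B) = A.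
Proof. by apply/matrixP => a b; rewrite !mxE. Qed.

Lemma inmx_dmx m n (A B : 'M_(m, n)) : inmx (dmx A B) = B.
Proof. by apply/matrixP => a b; rewrite !mxE. Qed.

Lemma stpart_sum (I : Type) (r : seq I) (P : pred I) (F : I -> dualnum T) :
  stpart (\sum_(i <- r | P i) F i) = \sum_(i <- r | P i) stpart (F i).
Proof. exact: (big_morph (@stpart T)). Qed.

Lemma inpart_sum (I : Type) (r : seq I) (P : pred I) (F : I -> dualnum T) :
  inpart (\sum_(i <- r | P i) F i) = \sum_(i <- r | P i) inpart (F i).
Proof. exact: (big_morph (@inpart T)). Qed.

Lemma dmxM m n p (A B : 'M_(m, n)) (C D : 'M_(n, p)) :
  dmx A B *m dmx C D = dmx (A *m C) (A *m D + B *m C).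
Proof.
apply/matrixP => a b; rewrite !mxE.
set x := \sum_ _ _; rewrite (_ : x = Dual (stpart x) (inpart x)); last by case: x.
rewrite stpart_sum inpart_sum -big_split.
by congr Dual; apply: eq_bigr => c _; rewrite !mxE.
Qed.

Lemma stmxM m n p (A : 'M_(m, n)) (B : 'M_(n, p)) :
  stmx (A *m B) = stmx A *m stmx B.
Proof. by rewrite -[A]dmx_eta -[B]dmx_eta dmxM !stmx_dmx. Qed.

Lemma dmx0 m n : dmx 0 0 = 0 :> 'M_(m, n).
Proof. by apply/matrixP => a b; rewrite !mxE. Qed.

Lemma dmx1 n : dmx 1%:M 0 = 1%:M :> 'M_n.
Proof. by apply/matrixP => a b; rewrite !mxE; case: eqP. Qed.

Lemma stmx1 n : stmx (1%:M : 'M_n) = 1%:M.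
Proof. by rewrite -dmx1 stmx_dmx. Qed.

Lemma dmx_block m1 m2 n1 n2 (A A' : 'M_(m1, n1)) (B B' : 'M_(m1, n2))
    (C C' : 'M_(m2, n1)) (D D' : 'M_(m2, n2)) :
  dmx (block_mx A B C D) (block_mx A' B' C' D') =
  block_mx (dmx A A') (dmx B B') (dmx C C') (dmx D D').
Proof.
apply/matrixP => a b; rewrite !mxE.
by case: (split a) => c; rewrite !mxE; case: (split b) => d; rewrite !mxE.
Qed.

Lemma dmx_row m n1 n2 (A A' : 'M_(m, n1)) (B B' : 'M_(m, n2)) :
  dmx (row_mx A B) (row_mx A' B') = row_mx (dmx A A') (dmx B B').
Proof. by apply/matrixP => a b; rewrite !mxE; case: (split b) => d; rewrite !mxE. Qed.

Lemma dmx_col m1 m2 n (A A' : 'M_(m1, n)) (B B' : 'M_(m2, n)) :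
  dmx (col_mx A B) (col_mx A' B') = col_mx (dmx A A') (dmx B B').
Proof. by apply/matrixP => a b; rewrite !mxE; case: (split a) => d; rewrite !mxE. Qed.
End DualMatrices.

Section DualQuaternionMatrices.
Variable R : comNzRingType.

Lemma star_dmx m n (A B : 'M[quat R]_(m, n)) :
  dqstar (dmx A B) = dmx (qstar A) (qstar B).
Proof. by apply/matrixP => a b; rewrite !mxE. Qed.

Lemma stmx_star m n (A : 'M[dualquat R]_(m, n)) : stmx (dqstar A) = qstar (stmx A).
Proof. by apply/matrixP => a b; rewrite !mxE. Qed.

Lemma inmx_star m n (A : 'M[dualquat R]_(m, n)) : inmx (dqstar A) = qstar (inmx A).
Proof. by apply/matrixP => a b; rewrite !mxE. Qed.

Lemma unitary_stmx n (U : 'M[dualquat R]_n) : dqunitary U -> qunitary (stmx U).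
Proof. by case=> U1 U2; split; rewrite -stmx_star -stmxM ?U1 ?U2 stmx1. Qed.

(** The matrix is [U] times [1 + eps K], and [(1 + eps K)^* (1 + eps K) = 1 + eps (K^* + K)], so a
    skew-Hermitian [K] preserves unitarity. *)
Lemma unitary_dmx n (U K : 'M[quat R]_n) :
  qunitary U -> qstar K = - K -> dqunitary (dmx U (U *m K)).
Proof.
move=> [U1 U2] KN; rewrite /unitary star_dmx starM !dmxM KN.
split; first by rewrite mulmxA U1 mul1mx -mulmxA U1 mulmx1 addrN dmx1.
by rewrite U2 mulNmx mulmxN mulmxA addNr dmx1.
Qed.

Lemma epsmxE m n (A : 'M[quat R]_(m, n)) : epsmx A = dmx 0 A.
Proof. by apply/matrixP => a b; rewrite !mxE. Qed.
End DualQuaternionMatrices.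

(** * The spectral theorem for quaternion matrices *)

Lemma mul_row_tr_ge0 (R : realFieldType) n (x : 'rV[R]_n) : 0 <= (x *m x^T) 0 0.
Proof. by rewrite mxE; apply: sumr_ge0 => a _; rewrite mxE -expr2 sqr_ge0. Qed.

Lemma mul_row_tr_eq0 (R : realFieldType) n (x : 'rV[R]_n) :
  (x *m x^T) 0 0 = 0 -> x = 0.
Proof.
move=> x0; apply/rowP => a; rewrite mxE; apply/eqP; rewrite -sqrf_eq0.
move/eqP: x0; rewrite mxE psumr_eq0 => [/allP/(_ a)|b _]; last first.
  by rewrite mxE -expr2 sqr_ge0.
by rewrite mem_index_enum mxE -expr2; apply.
Qed.

(** Over the algebraically closed complexification there is an eigenvector [x + i y] with eigenvalue
    [a + i b]. Symmetry forces [b = 0], and then whichever of [x] and [y] is nonzero is a real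
    eigenvector. *)
Lemma symmetric_eigenvector (R : rcfType) n (S : 'M[R]_n) :
  (0 < n)%N -> S^T = S -> exists l (x : 'rV[R]_n), x != 0 /\ x *m S = l *: x.
Proof.
move=> n_gt0 Ssym.
have [[a b] /eigenvalueP[v vS v0]] :=
  eigenvalue_closed (map_mx (real_complex R) S) n_gt0.
pose x := map_mx (@complex.Re R) v; pose y := map_mx (@complex.Im R) v.
have xS : x *m S = a *: x - b *: y.
  apply/rowP => c; move/rowP/(_ c): vS; rewrite !mxE => /(congr1 (@complex.Re R)).
  rewrite (_ : complex.Re (_ * _) = a * complex.Re (v 0 c) - b * complex.Im (v 0 c));
    last by case: (v 0 c).
  rewrite raddf_sum /= => <-.
  by apply: eq_bigr => k _; rewrite !mxE; case: (v 0 k) => ? ? /=; ring.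
have yS : y *m S = a *: y + b *: x.
  apply/rowP => c; move/rowP/(_ c): vS; rewrite !mxE => /(congr1 (@complex.Im R)).
  rewrite (_ : complex.Im (_ * _) = a * complex.Im (v 0 c) + b * complex.Re (v 0 c));
    last by case: (v 0 c).
  rewrite raddf_sum /= => <-.
  by apply: eq_bigr => k _; rewrite !mxE; case: (v 0 k) => ? ? /=; ring.
have xy0 : (x != 0) || (y != 0).
  apply: contraNT v0; rewrite negb_or !negbK => /andP[/eqP x0 /eqP y0].
  apply/eqP/rowP => c; move/rowP/(_ c): x0; move/rowP/(_ c): y0; rewrite !mxE.
  by case: (v 0 c) => ? ? /= -> ->.
have tr00 (M : 'M[R]_1) : M 0 0 = M^T 0 0 by rewrite mxE.
have b0 : b = 0.
  have yx : (y *m x^T) 0 0 = (x *m y^T) 0 0.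
    by rewrite [LHS]tr00 trmx_mul trmxK.
  (* Expanding both sides by [xS] and [yS] gives [b (|x|^2 + |y|^2) = 0]. *)
  have : (x *m S *m y^T) 0 0 = (y *m S *m x^T) 0 0.
    by rewrite [RHS]tr00 !trmx_mul trmxK Ssym mulmxA.
  have lin (c d : R) (M N : 'M[R]_1) : (c *: M + d *: N) 0 0 = c * M 0 0 + d * N 0 0.
    by rewrite !mxE.
  rewrite xS yS -scaleNr !mulmxDl -!scalemxAl !lin yx => E.
  have {}E : b * ((x *m x^T) 0 0 + (y *m y^T) 0 0) = 0 by lra.
  move/eqP: E; rewrite mulf_eq0 => /orP[/eqP //|].
  rewrite paddr_eq0 ?mul_row_tr_ge0 // => /andP[/eqP/mul_row_tr_eq0 x0].
  by move=> /eqP/mul_row_tr_eq0 y0; rewrite x0 y0 eqxx in xy0.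
exists a; case/orP: xy0 => [x0|y0]; [exists x | exists y]; split=> //.
  by rewrite xS b0 scale0r subr0.
by rewrite yS b0 scale0r addr0.
Qed.

Lemma hermitian_eigenvector (R : rcfType) n (G : 'M[quat R]_n) :
  (0 < n)%N -> qstar G = G ->
  exists l (x : 'cV[quat R]_n), x != 0 /\ G *m x = real_quat l *: x.
Proof.
move=> n_gt0 Gherm.
pose Ga := map_mx (@qre R) G; pose Gb := map_mx (@qim R) G.
pose Gc := map_mx (@qjm R) G; pose Gd := map_mx (@qkm R) G.
(* [S] is the real matrix of left multiplication by [G] on columns, in the coordinates [1, i, j, k].
   As [G] is Hermitian, [Ga] is symmetric and [Gb], [Gc], [Gd] are antisymmetric, which makes [S]
   symmetric. *)
pose S := block_mx (block_mx Ga (- Gb) Gb Ga) (block_mx (- Gc) (- Gd) (- Gd) Gc)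
                   (block_mx Gc Gd Gd (- Gc)) (block_mx Ga (- Gb) Gb Ga).
have GaT : Ga^T = Ga.
  by apply/matrixP => a b; rewrite /Ga -[in RHS]Gherm !mxE.
have GbT : Gb^T = - Gb.
  by apply/matrixP => a b; rewrite /Gb -[in RHS]Gherm !mxE opprK.
have GcT : Gc^T = - Gc.
  by apply/matrixP => a b; rewrite /Gc -[in RHS]Gherm !mxE opprK.
have GdT : Gd^T = - Gd.
  by apply/matrixP => a b; rewrite /Gd -[in RHS]Gherm !mxE opprK.
have Ssym : S^T = S.
  by rewrite /S !tr_block_mx !linearN /= GaT GbT GcT GdT !opprK.
have [|l [y [y0 yS]]] := symmetric_eigenvector _ Ssym.
  by rewrite addn_gt0 addn_gt0 n_gt0.
have {yS} : S *m y^T = l *: y^T by rewrite -[S]Ssym -trmx_mul yS linearZ.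
have {y0} : y^T != 0 by apply: contraNneq y0 => /(congr1 trmx); rewrite trmxK trmx0 => ->.
rewrite -[y^T]vsubmxK -[usubmx y^T]vsubmxK -[dsubmx y^T]vsubmxK.
move: (usubmx (usubmx _)) (dsubmx (usubmx _)) (usubmx (dsubmx _)) (dsubmx (dsubmx _)).
move=> xa xb xc xd x0; rewrite /S !mul_block_col !add_col_mx !scale_col_mx.
rewrite !mulNmx => /eq_col_mx[/eq_col_mx[Ea Eb] /eq_col_mx[Ec Ed]].
exists l, (\col_c Quat (xa c 0) (xb c 0) (xc c 0) (xd c 0)); split.
  apply: contraNneq x0 => /colP x0.
  apply/eqP; rewrite -[RHS]vsubmxK -[usubmx 0]vsubmxK -[dsubmx 0]vsubmxK !linear0.
  by congr (col_mx (col_mx _ _) (col_mx _ _)); apply/colP => c;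
    have := x0 c; rewrite !mxE; case.
have sumE f : {morph f : x y / x + y >-> x + y} -> f 0 = 0 -> forall F,
    f (\sum_(k < n) F k : quat R) = \sum_(k < n) f (F k) :> R.
  by move=> fD f0 F; apply: (big_morph f).
apply/colP => c; rewrite !mxE; rewrite [LHS]quat_eta !sumE //.
move/colP/(_ c): Ea; move/colP/(_ c): Eb; move/colP/(_ c): Ec; move/colP/(_ c): Ed.
rewrite !mxE -!sumrN -!big_split /= => Ed Ec Eb Ea; congr Quat.
- by rewrite /= !mul0r !subr0 -Ea; apply: eq_bigr => k _; rewrite !mxE /=; ring.
- by rewrite /= !mul0r !subr0 !addr0 -Eb; apply: eq_bigr => k _; rewrite !mxE /=; ring.
- by rewrite /= !mul0r !subr0 !addr0 -Ec; apply: eq_bigr => k _; rewrite !mxE /=; ring.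
- by rewrite /= !mul0r !subr0 !addr0 -Ed; apply: eq_bigr => k _; rewrite !mxE /=; ring.
Qed.

(** * Norms of quaternion columns and the polar form of a quaternion *)

Section QuaternionVectors.
Variable R : rcfType.
Implicit Types n : nat.

Lemma qnorm2_ge0 (x : quat R) : 0 <= qnorm2 x.
Proof. by rewrite /qnorm2 !addr_ge0 ?sqr_ge0. Qed.

Lemma qnorm2_eq0 (x : quat R) : qnorm2 x = 0 -> x = 0.
Proof.
case: x => a b c d; rewrite /qnorm2 /=.
move/eqP; rewrite !paddr_eq0 ?addr_ge0 ?sqr_ge0 // !sqrf_eq0.
by move=> /andP[/andP[/andP[/eqP-> /eqP->] /eqP->] /eqP->].
Qed.

Lemma real_quat_sum (I : Type) (r : seq I) (P : pred I) (F : I -> R) :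
  real_quat (\sum_(i <- r | P i) F i) = \sum_(i <- r | P i) real_quat (F i).
Proof. exact: (big_morph (@real_quat R) (@real_quatD R)). Qed.

Definition vnorm2 n (x : 'cV[quat R]_n) : R := \sum_a qnorm2 (x a 0).

Lemma vnorm2E n (x : 'cV_n) : qstar x *m x = (real_quat (vnorm2 x))%:M.
Proof.
apply/matrixP => a b; rewrite !ord1 !mxE eqxx mulr1n real_quat_sum.
by apply: eq_bigr => c _; rewrite !mxE conj_mulq.
Qed.

Lemma vnorm2_ge0 n (x : 'cV_n) : 0 <= vnorm2 x.
Proof. by apply: sumr_ge0 => a _; apply: qnorm2_ge0. Qed.

Lemma vnorm2_eq0 n (x : 'cV_n) : vnorm2 x = 0 -> x = 0.
Proof.
move/eqP; rewrite psumr_eq0 => [/allP x0|a _]; last exact: qnorm2_ge0.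
apply/colP => a; rewrite mxE; apply: qnorm2_eq0.
by apply/eqP/x0; rewrite mem_index_enum.
Qed.

Lemma vnorm2_gt0 n (x : 'cV_n) : x != 0 -> 0 < vnorm2 x.
Proof.
move=> x0; rewrite lt_neqAle vnorm2_ge0 andbT eq_sym.
by apply: contraNneq x0 => /vnorm2_eq0 ->.
Qed.

Lemma normalize n (x : 'cV_n) : x != 0 ->
  let y := real_quat (Num.sqrt (vnorm2 x))^-1 *: x in qstar y *m y = 1%:M.
Proof.
move=> /vnorm2_gt0 x0 y; rewrite /y (starZ (real_quatP _)) (scale_mulmxr (real_quatP _)).
rewrite -scalemxAl scalerA vnorm2E -real_quatM -invfM -expr2 sqr_sqrtr ?ltW //.
by rewrite scale_scalar_mx -real_quatM mulVf ?gt_eqF.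
Qed.

Lemma quat_conj0 : quat_conj 0 = 0 :> quat R.
Proof. exact: (invo0 (quat_involution R)). Qed.

Lemma quat_conj1 : quat_conj 1 = 1 :> quat R.
Proof. exact: (invo1 (quat_involution R)). Qed.

(** The phase of [a] is [c = a / |a|], taken to be [1] when [a = 0]. It serves to make an inner
    product real and nonnegative. *)
Lemma quat_polar (a : quat R) : exists c, [/\ quat_conj c * c = 1, c * quat_conj c = 1,
  quat_conj a * c = real_quat (Num.sqrt (qnorm2 a)) &
  quat_conj c * a = real_quat (Num.sqrt (qnorm2 a))].
Proof.
have [->|a0] := eqVneq a 0.
  exists 1; rewrite quat_conj0 quat_conj1 !mulr1 mulr0.
  by split=> //; rewrite /qnorm2 expr0n !addr0 sqrtr0.
pose al := Num.sqrt (qnorm2 a).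
have q0 : qnorm2 a != 0 by apply: contraNneq a0 => /qnorm2_eq0 ->.
have al2 : qnorm2 a = al * al by rewrite -expr2 sqr_sqrtr ?qnorm2_ge0.
have al0 : al != 0 by apply: contraNneq q0 => al0; rewrite al2 al0 mulr0.
have [rC _] := real_quatP al^-1.
have rS : quat_conj (real_quat al^-1) = real_quat al^-1 := (real_quatP _).2.
have E : real_quat al^-1 * real_quat (qnorm2 a) = real_quat al.
  by rewrite -real_quatM al2 mulKf.
have E1 : real_quat al^-1 * real_quat al = 1 by rewrite -real_quatM mulVf.
exists (real_quat al^-1 * a).
have -> : quat_conj (real_quat al^-1 * a) = real_quat al^-1 * quat_conj a.
  by rewrite quat_conjM rS rC.
split.
- by rewrite -mulrA (mulrA (quat_conj a)) -(rC (quat_conj a)) -mulrA conj_mulq E.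
- by rewrite -mulrA (mulrA a) -(rC a) -mulrA mulq_conj E.
- by rewrite mulrA -rC -mulrA conj_mulq E.
- by rewrite -mulrA conj_mulq E.
Qed.
End QuaternionVectors.

Section UnitaryExtension.
Variable R : rcfType.

(** Householder's construction: with [c] the phase of the first entry of [u], a unitary involution
    [H] takes [e c] to [u], so that [H diag(c, 1)] is unitary with first column [u]. *)
Lemma unitary_col_ext n (u : 'cV[quat R]_(1 + n)) : qstar u *m u = 1%:M ->
  exists U' : 'M_(1 + n, n), qunitary (row_mx u U').
Proof.
move=> u1; pose e : 'cV[quat R]_(1 + n) := col_mx 1%:M 0.
have eS : qstar e = row_mx 1%:M 0 by rewrite star_col star1 star0.
have [c [cc1 cc2 ac ca]] := quat_polar (u 0 0).
set al := Num.sqrt _ in ac ca.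
have eu : qstar e *m u = (u 0 0)%:M.
  rewrite -[u in LHS]vsubmxK eS mul_row_col mul1mx mul0mx addr0.
  by apply/matrixP => a b; rewrite !ord1 !mxE lshift0.
have ue : qstar u *m e = (quat_conj (u 0 0))%:M.
  by rewrite -[LHS](starK (quat_involution R)) starM starK eu; apply/matrixP => a b; rewrite !ord1 !mxE.
have ee : qstar e *m e = 1%:M by rewrite eS mul_row_col mul1mx mul0mx addr0.
have cS : qstar c%:M = (quat_conj c)%:M :> 'M_1.
  by apply/matrixP => a b; rewrite !ord1 !mxE.
(* The phase [c] makes the inner product of [u] and [ec] equal to [al >= 0], so [|z|^2 = 2 (1 + al)]
   is never zero. *)
pose ec := e *m c%:M; pose z := u + ec; pose t := real_quat (1 + al).
have al1 : 1 + al != 0 by rewrite gt_eqF // ltr_pwDl ?sqrtr_ge0.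
pose k := real_quat (1 + al)^-1.
have kt : k * t = 1 by rewrite -real_quatM mulVf.
have zec : qstar z *m ec = t%:M.
  rewrite starD starM cS mulmxDl mulmxA ue -scalar_mxM -mulmxA (mulmxA _ e) ee mul1mx.
  by rewrite -scalar_mxM ac cc1 -raddfD addrC /t real_quatD.
have zz : qstar z *m z = (t + t)%:M.
  rewrite {2}/z mulmxDr zec raddfD /=; congr (_ + _).
  rewrite starD starM cS mulmxDl u1 -mulmxA eu -scalar_mxM ca -raddfD.
  by rewrite /t real_quatD.
pose N := z *m qstar z.
have NS : qstar N = N by rewrite starM starK.
have NN : N *m N = (t + t) *: N.
  have [tC _] := real_quatP (1 + al + (1 + al)).
  rewrite /N mulmxA -(mulmxA z) zz -scalemx1 (scale_mulmxr (f := quat_involution R)) ?mulmx1 -?scalemxAl //.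
  by rewrite /t -real_quatD; apply: real_quatP.
(* This is [2 z z^* / |z|^2 - 1], which fixes [z] and negates its orthogonal complement; it
   exchanges [u] and [ec]. *)
pose H := k *: N - 1%:M.
have HS : qstar H = H by rewrite starD starN star1 (starZ (real_quatP _)) NS.
have HH : H *m H = 1%:M.
  rewrite mulmxBl !mulmxBr !mulmx1 mul1mx (scale_mulmxr (real_quatP _)) -scalemxAl NN.
  rewrite scalerDl (scalerDr k) scalerA kt scale1r scalerDr opprB addrA.
  by rewrite -/k addrK addrAC subrr add0r.
have Hec : H *m ec = u.
  rewrite mulmxBl mul1mx -scalemxAl -mulmxA zec -scalemx1 (scale_mulmxr (real_quatP _)).
  by rewrite mulmx1 scalerA kt scale1r addrK.
pose W := H *m block_mx c%:M 0 0 1%:M.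
have WU : qunitary W.
  apply: unitaryM; first by split; rewrite HS.
  by apply: unitary_block (unitary1 _ _); split; rewrite cS -scalar_mxM ?cc1 ?cc2.
exists (rsubmx W); rewrite (_ : u = lsubmx W) ?hsubmxK //.
rewrite -Hec /W -[H]hsubmxK mul_row_block !mulmx0 addr0 add0r row_mxKl.
by rewrite /ec mul_col_mx mul_row_col mul1mx mul0mx mulmx0 addr0.
Qed.
End UnitaryExtension.

Lemma unitary_rowP (T : nzRingType) (f : involution T) m n1 n2
    (U : 'M[T]_(m, n1)) (V : 'M_(m, n2)) :
  star f (row_mx U V) *m row_mx U V = 1%:M ->
  [/\ star f U *m U = 1%:M, star f U *m V = 0, star f V *m U = 0
    & star f V *m V = 1%:M].
Proof. by rewrite star_row mul_col_row (scalar_mx_block n1 n2) => /eq_block_mx[]. Qed.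

(** Complete the standard part to a unitary [W = row_mx u0 U0] and correct it to [W (1 + eps K)].
    The first column of [K] has to be [W^* u1]; the infinitesimal part of [u^* u = 1] says that its
    top entry is skew, so it extends to a skew-Hermitian [K]. *)
Lemma dual_unitary_col_ext (R : rcfType) n (u : 'cV[dualquat R]_(1 + n)) :
  dqstar u *m u = 1%:M -> exists U' : 'M_(1 + n, n), dqunitary (row_mx u U').
Proof.
rewrite -[u]dmx_eta star_dmx dmxM -dmx1; move: (stmx u) (inmx u) => u0 u1 E.
have := congr1 (@stmx _ _ _) E; have := congr1 (@inmx _ _ _) E.
rewrite !stmx_dmx !inmx_dmx => {E}u01 u00.
have [U0 W0] := unitary_col_ext u00.
have [_ u0U0 _ _] := unitary_rowP W0.1.
pose y := qstar (row_mx u0 U0) *m u1.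
have yE : y = col_mx (qstar u0 *m u1) (qstar U0 *m u1) by rewrite /y star_row mul_col_mx.
pose K := block_mx (qstar u0 *m u1) (- qstar (qstar U0 *m u1)) (qstar U0 *m u1) 0.
have KS : qstar K = - K.
  rewrite star_block starN starK star0 opp_block_mx oppr0 opprK.
  by congr block_mx; apply/eqP; rewrite starM starK -addr_eq0 addrC u01.
have := unitary_dmx W0 KS.
have : lsubmx (dmx (row_mx u0 U0) (row_mx u0 U0 *m K)) = dmx u0 u1.
  by rewrite /K block_mxEh mul_mx_row -yE dmx_row row_mxKl /y mulmxA W0.2 mul1mx.
move: (dmx (row_mx u0 U0) _) => D DE DU.
by exists (rsubmx D); rewrite -DE hsubmxK.
Qed.

Lemma star_conjM (T : nzRingType) (f : involution T) m n p (A : 'M[T]_(m, n))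
    (B : 'M_(n, p)) (G : 'M_m) :
  star f (A *m B) *m G *m (A *m B) = star f B *m (star f A *m G *m A) *m B.
Proof. by rewrite starM !mulmxA. Qed.

(** Induction on the size: in a unitary basis that starts with a unit eigenvector, the Hermitian [G]
    is block diagonal, and its second block is again Hermitian. *)
Lemma hermitian_spectral (R : rcfType) n (G : 'M[quat R]_n) : qstar G = G ->
  exists (W : 'M[quat R]_n) (d : 'rV[R]_n),
    qunitary W /\ qstar W *m G *m W = diag_mx (map_mx (@real_quat R) d).
Proof.
elim: n => [|n IHn] in G * => GS.
  by exists 1%:M, 0; split; [exact: unitary1 | rewrite [LHS]flatmx0 [RHS]flatmx0].
suff: exists (W : 'M[quat R]_(1 + n)) (d : 'rV[R]_(1 + n)),
    qunitary W /\ qstar W *m (G : 'M_(1 + n)) *m W = diag_mx (map_mx (@real_quat R) d) by [].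
have [//|l [x [x0 Gx]]] := hermitian_eigenvector _ GS.
pose u : 'cV_(1 + n) := real_quat (Num.sqrt (vnorm2 x))^-1 *: x.
have u1 : qstar u *m u = 1%:M := normalize x0.
have Gu : G *m u = real_quat l *: u.
  rewrite (scale_mulmxr (real_quatP _)) Gx !scalerA; congr (_ *: _).
  exact: (real_quatP _).1.
have [U UU] := unitary_col_ext u1.
have [_ uU Uu U1] := unitary_rowP UU.1.
have uG : qstar u *m G = real_quat l *: qstar u.
  by rewrite -[G in LHS]GS -starM Gu (starZ (real_quatP _)).
have [|W [d [WU WG]]] := IHn (qstar U *m G *m U); first by rewrite !starM starK GS mulmxA.
exists (row_mx u U *m block_mx 1%:M 0 0 W), (row_mx l%:M d); split.
  exact: unitaryM UU (unitary_block (unitary1 _ _) WU).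
have E : qstar (row_mx u U) *m G *m row_mx u U =
    block_mx (real_quat l)%:M 0 0 (qstar U *m G *m U).
  rewrite star_row mul_col_mx mul_col_row uG -!scalemxAl u1 uU scaler0.
  by rewrite -(mulmxA _ G) Gu (scale_mulmxr (real_quatP _)) Uu scaler0 scalemx1.
rewrite star_conjM E star_block star1 !star0 !mulmx_block !mulmx0 !mul0mx !addr0 !add0r mul1mx mulmx1.
rewrite WG map_row_mx diag_mx_row; congr block_mx; rewrite ?mul0mx //.
by apply/matrixP => a b; rewrite !ord1 !mxE.
Qed.

Lemma spectral_diag_neq0 (R : rcfType) n (G W : 'M[quat R]_n) (d : 'rV[R]_n) :
  qunitary W -> qstar W *m G *m W = diag_mx (map_mx (@real_quat R) d) -> G != 0 ->
  exists a, d 0 a != 0.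
Proof.
move=> [W1 W2] WG G0; apply/existsP; apply: contra_neqT G0.
rewrite negb_exists => /forallP d0.
rewrite -[G]mul1mx -[G]mulmx1 -W2 !mulmxA -(mulmxA _ (qstar W)) -(mulmxA _ _ W) WG.
rewrite (_ : diag_mx _ = 0) ?mulmx0 ?mul0mx //; apply/matrixP => b c.
by have := d0 b; rewrite negbK !mxE => /eqP->; apply: mul0rn.
Qed.

Lemma hermitian_nonzero_eigenvector (R : rcfType) n (G : 'M[quat R]_n) :
  qstar G = G -> G != 0 ->
  exists l (x : 'cV[quat R]_n),
    [/\ l != 0, qstar x *m x = 1%:M & G *m x = real_quat l *: x].
Proof.
move=> GS G0; have [W [d [WU WG]]] := hermitian_spectral GS.
have [a da] := spectral_diag_neq0 WU WG G0; have [W1 W2] := WU.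
pose e : 'cV[quat R]_n := delta_mx a 0.
exists (d 0 a), (W *m e); split=> //.
  rewrite starM mulmxA -(mulmxA _ _ W) W1 mulmx1.
  apply/matrixP => b c; rewrite !ord1 !mxE (bigD1 a) //= big1.
    by rewrite !mxE !eqxx /= addr0 mulr1 quat_conj1.
  by move=> k ka; rewrite !mxE (negPf ka) mulr0.
have GW : G *m W = W *m diag_mx (map_mx (@real_quat R) d).
  by rewrite -WG !mulmxA W2 mul1mx.
rewrite mulmxA GW -mulmxA -(scale_mulmxr (real_quatP _)); congr (_ *m _).
apply/colP => b; rewrite mul_diag_mx !mxE.
by case: (eqVneq b a) => [->|]; rewrite ?mulr0.
Qed.

(** * The singular value decomposition over the dual quaternions *)

Section DualEigenvectors.
Variable R : rcfType.

Lemma scale_dq_of_dual (l : dualnum R) m n (A B : 'M[quat R]_(m, n)) :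
  dq_of_dual l *: dmx A B = dmx (real_quat (stpart l) *: A)
    (real_quat (stpart l) *: B + real_quat (inpart l) *: A).
Proof. by apply/matrixP => a b; rewrite !mxE. Qed.

(* First-order perturbation theory: in the eigenspace of [d 0 c] the infinitesimal
   part of [G] is diagonalised, which fixes the standard part of the eigenvector. *)
Lemma dual_eigenvector_diag n (G : 'M[dualquat R]_n) (d : 'rV[R]_n) c :
  dqstar G = G -> stmx G = diag_mx (map_mx (@real_quat R) d) ->
  exists nu (v : 'cV[dualquat R]_n), dqstar v *m v = 1%:M /\
    G *m v = dq_of_dual (Dual (d 0 c) nu) *: v.
Proof.
move=> GS Gst; set l := d 0 c; have := dmx_eta G; rewrite Gst => GE.
have: qstar (inmx G) = inmx G by rewrite -inmx_star GS.
move: (inmx G) GE => G1 GE G1S.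
have [nu [x [x1 x0 xnu]]] : exists nu (x : 'cV[quat R]_n),
    [/\ qstar x *m x = 1%:M, forall a, d 0 a != l -> x a 0 = 0
      & forall a, d 0 a = l -> (G1 *m x) a 0 = real_quat nu * x a 0].
  (* [K] is the infinitesimal part of [G] compressed to the eigenspace of [l]. *)
  pose K : 'M[quat R]_n :=
    \matrix_(a, b) if (d 0 a == l) && (d 0 b == l) then G1 a b else 0.
  have KS : qstar K = K.
    apply/matrixP => a b; rewrite !mxE andbC -[in RHS]G1S mxE.
    by case: ifP => // _; rewrite /= quat_conj0.
  have Kx (x : 'cV_n) : (forall a, d 0 a != l -> x a 0 = 0) ->
      forall a, d 0 a = l -> (G1 *m x) a 0 = (K *m x) a 0.
    move=> x0 a da; rewrite !mxE; apply: eq_bigr => b _; rewrite mxE da eqxx /=.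
    by case: eqVneq => // /x0 ->; rewrite !mulr0.
  (* If [K] vanishes, the basis vector of index [c] will do, with [nu = 0]. Otherwise an eigenvector
     for a nonzero eigenvalue lies in the eigenspace of [l], because the rows of [K] outside it are
     zero. *)
  have [K0|/(hermitian_nonzero_eigenvector KS)] := eqVneq K 0.
    exists 0, (delta_mx c 0); have dc a : d 0 a != l -> (delta_mx c 0 : 'cV[quat R]_n) a 0 = 0.
      by rewrite !mxE; case: (eqVneq a c) => // ->; rewrite /l eqxx.
    split=> [|a /dc //|a da]; last by rewrite (Kx _ dc) // K0 mul0mx [RHS]mul0r mxE.
    apply/matrixP => a b; rewrite !ord1 !mxE (bigD1 c) //= big1.
      by rewrite !mxE !eqxx /= addr0 mulr1 quat_conj1.
    by move=> k kc; rewrite !mxE (negPf kc) mulr0.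
  move=> [nu [x [nu0 x1 Kxnu]]].
  have x0 a : d 0 a != l -> x a 0 = 0.
    move=> da; have: (K *m x) a 0 = 0.
      by rewrite mxE big1 // => b _; rewrite mxE (negPf da) mul0r.
    rewrite Kxnu mxE => /(congr1 ( *%R (real_quat nu^-1))).
    by rewrite mulrA -real_quatM mulVf // mulr0 mul1r.
  by exists nu, x; split=> // a da; rewrite Kx // Kxnu mxE.
have [w wE] : exists w, w = G1 *m x by exists (G1 *m x).
(* Outside the eigenspace [y] solves [(l - d 0 a) y_a = w_a]. Inside it [y] is zero, which makes [y]
   orthogonal to [x] and keeps [x + eps y] of norm [1]. *)
rewrite -wE in xnu; pose y : 'cV[quat R]_n :=
  \col_a if d 0 a == l then 0 else real_quat (l - d 0 a)^-1 * w a 0.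
have xy : qstar x *m y = 0.
  apply/matrixP => a b; rewrite !mxE big1 // => k _; rewrite !mxE ord1.
  by case: eqVneq => [_|/x0->]; rewrite ?mulr0 //= quat_conj0 mul0r.
exists nu, (dmx x y); split.
  rewrite star_dmx dmxM x1 xy add0r -[X in dmx _ X](starK (quat_involution R)) starM starK xy.
  by rewrite star0 dmx1.
rewrite -GE dmxM scale_dq_of_dual /=; congr dmx; apply/colP => a.
  rewrite mul_diag_mx !mxE; case: (eqVneq (d 0 a) l) => [->//|/x0->].
  by rewrite !mulr0.
rewrite -wE mul_diag_mx !mxE.
have [da|da] := eqVneq (d 0 a) l; first by rewrite !mulr0 !add0r xnu.
rewrite (x0 _ da) mulr0 addr0 -{2}[w a 0]mul1r !mulrA -!real_quatM -mulrDl.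
congr (_ * _); rewrite -[1]/(real_quat 1) -real_quatD; congr real_quat.
have dl : l - d 0 a != 0 by rewrite subr_eq0 eq_sym.
by rewrite -[X in _ + X](mulfV dl) -mulrDl addrC subrK.
Qed.
End DualEigenvectors.

Section DualSVD.
Variable R : realType.

Lemma gram_eq0 m n (A : 'M[quat R]_(m, n)) : qstar A *m A = 0 -> A = 0.
Proof.
move=> A0; apply/matrixP => a b; rewrite mxE.
have /vnorm2_eq0/colP/(_ a) : vnorm2 (col b A) = 0; last by rewrite !mxE.
apply: real_quat_inj; move/matrixP/(_ b b): A0; rewrite !mxE => E; apply: etrans E.
by rewrite real_quat_sum; apply: eq_bigr => k _; rewrite !mxE conj_mulq.
Qed.

(** A nonzero eigenvalue of the standard part of [M^* M] is lifted to a dual one by perturbation.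
    For a unit eigenvector [v] its standard part is [|M v|^2], computed on standard parts, hence
    positive. *)
Lemma gram_dual_eigenvector m n (M : 'M[dualquat R]_(m, n)) : stmx M != 0 ->
  exists l (v : 'cV[dualquat R]_n), [/\ 0 < stpart l, dqstar v *m v = 1%:M
    & dqstar M *m M *m v = dq_of_dual l *: v].
Proof.
move=> M0; have [G GE] : exists G, G = dqstar M *m M by eexists.
have GS : dqstar G = G by rewrite GE starM starK.
have G0 : stmx G != 0.
  by apply: contraNneq M0; rewrite GE stmxM stmx_star => /gram_eq0 ->.
have G0S : qstar (stmx G) = stmx G by rewrite -stmx_star GS.
have [W [d [WU WG]]] := hermitian_spectral G0S.
have [c dc] := spectral_diag_neq0 WU WG G0.
have [|W1 W2] := @unitary_dmx _ _ W 0 WU; first by rewrite star0 oppr0.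
rewrite mulmx0 in W1 W2; have [V VE] : exists V, V = dmx W 0 by eexists.
rewrite -VE in W1 W2.
have [||nu [v [v1 vnu]]] := @dual_eigenvector_diag _ _ (dqstar V *m G *m V) d c.
- by rewrite !starM starK GS mulmxA.
- by rewrite !stmxM stmx_star VE stmx_dmx.
have v1' : dqstar (V *m v) *m (V *m v) = 1%:M.
  by rewrite starM mulmxA -(mulmxA _ _ V) W1 mulmx1.
have Gv : G *m (V *m v) = dq_of_dual (Dual (d 0 c) nu) *: (V *m v).
  rewrite -[LHS]mul1mx -W2 -(scale_mulmxr (dq_of_dualP _)) -vnu.
  by rewrite !mulmxA.
exists (Dual (d 0 c) nu), (V *m v); rewrite -GE; split=> //=.
rewrite lt_neqAle eq_sym dc.
have -> : d 0 c = vnorm2 (stmx M *m stmx (V *m v)).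
  apply: real_quat_inj.
  suff /matrixP/(_ 0 0) : (real_quat (d 0 c))%:M =
      (real_quat (vnorm2 (stmx M *m stmx (V *m v))))%:M :> 'M_1 by rewrite !mxE.
  rewrite -vnorm2E -stmxM -stmx_star -stmxM starM -mulmxA (mulmxA (dqstar M)) -GE Gv.
  rewrite (scale_mulmxr (dq_of_dualP _)) v1' scalemx1.
  by apply/matrixP => a b; rewrite !ord1 !mxE.
exact: vnorm2_ge0.
Qed.

Lemma dual_singular_pair m n (M : 'M[dualquat R]_(m, n)) : stmx M != 0 ->
  exists mu (u : 'cV[dualquat R]_m) (v : 'cV[dualquat R]_n),
    [/\ 0 < stpart mu, dqstar u *m u = 1%:M, dqstar v *m v = 1%:M,
        M *m v = dq_of_dual mu *: u & dqstar M *m u = dq_of_dual mu *: v].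
Proof.
move=> /gram_dual_eigenvector[[l0 l1] [v [/= l0_gt0 v1 Gv]]].
set s := Num.sqrt l0; have s_gt0 : 0 < s by rewrite sqrtr_gt0.
have ss : s * s = l0 by rewrite -expr2 sqr_sqrtr ?ltW.
have s_neq0 := lt0r_neq0 s_gt0.
(* [mu] is the dual square root of [l0 + l1 eps] and [mui] its inverse; both exist because
   [l0 > 0]. *)
pose mu := Dual s (l1 / (2 * s)); pose mui := Dual s^-1 (- (l1 / (2 * s)) / (s * s)).
have mui_mu : mui * mu = 1.
  by congr Dual; rewrite /=; field.
have mu_mui : mu * mui = 1.
  by congr Dual; rewrite /=; field.
have mu_mu : Dual l0 l1 = mu * mu.
  by congr Dual; rewrite /= ?ss //; field.
have K (x : dualnum R) : dq_of_dual mui * dq_of_dual (mu * x) = dq_of_dual x.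
  by rewrite -dq_of_dualM mulrA mui_mu mul1r.
exists mu, (dq_of_dual mui *: (M *m v)), v; split; [exact: s_gt0 | | exact: v1 | | ].
- rewrite (starZ (dq_of_dualP _)) (scale_mulmxr (dq_of_dualP _)) -scalemxAl.
  rewrite starM -mulmxA (mulmxA (dqstar M)) Gv (scale_mulmxr (dq_of_dualP _)) v1.
  by rewrite !scalerA -mulrA mu_mu K -dq_of_dualM mui_mu scale1r.
- by rewrite scalerA -dq_of_dualM mu_mui scale1r.
- rewrite (scale_mulmxr (dq_of_dualP _)) mulmxA Gv scalerA mu_mu K.
  reflexivity.
Qed.

(** In the completed bases [(u U)] and [(v V)] the off-diagonal blocks are [U^* M v = mu U^* u = 0]
    and [u^* M V = mu v^* V = 0]. *)
Lemma dual_svd_peel_appreciable m n (M : 'M[dualquat R]_(1 + m, 1 + n)) :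
  stmx M != 0 ->
  exists mu (U : 'M[dualquat R]_(1 + m)) (V : 'M[dualquat R]_(1 + n)) M',
    [/\ 0 < stpart mu, dqunitary U, dqunitary V
      & dqstar U *m M *m V = block_mx (dq_of_dual mu)%:M 0 0 M'].
Proof.
move=> /dual_singular_pair[mu [u [v [mu_gt0 u1 v1 Mv Mu]]]].
have [U UU] := dual_unitary_col_ext u1; have [V VU] := dual_unitary_col_ext v1.
have [_ _ Uu _] := unitary_rowP UU.1; have [_ vV _ _] := unitary_rowP VU.1.
exists mu, (row_mx u U), (row_mx v V), (dqstar U *m M *m V); split=> //.
rewrite star_row mul_col_mx mul_col_row -!(mulmxA _ M v) Mv.
rewrite !(scale_mulmxr (dq_of_dualP _)) u1 Uu scaler0 scalemx1.
have -> : dqstar u *m M = dq_of_dual mu *: dqstar v.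
  by rewrite -[M](starK (dq_involution R)) -starM Mu (starZ (dq_of_dualP _)).
by rewrite -scalemxAl vV scaler0.
Qed.

Lemma dual_svd_peel m n (M : 'M[dualquat R]_(1 + m, 1 + n)) : M != 0 ->
  exists mu (U : 'M[dualquat R]_(1 + m)) (V : 'M[dualquat R]_(1 + n)) M',
    [/\ dual_gt mu 0, dqunitary U, dqunitary V
      & dqstar U *m M *m V = block_mx (dq_of_dual mu)%:M 0 0 M'].
Proof.
have [M0 Mn0|M0 _] := eqVneq (stmx M) 0; last first.
  have [mu [U [V [M' [mu_gt0 UU VU E]]]]] := dual_svd_peel_appreciable M0.
  by exists mu, U, V, M'; split=> //; rewrite /dual_gt /= mu_gt0.
(* Here [M = eps N] with [N] appreciable, and [eps] is central. *)
pose eps : dualnum R := Dual 0 1.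
pose N := dmx (inmx M) 0.
have MN : M = dq_of_dual eps *: N.
  rewrite scale_dq_of_dual -[LHS]dmx_eta M0 /=; congr dmx; apply/matrixP => a b.
    by rewrite !mxE mul0r.
  by rewrite !mxE mulr0 add0r mul1r.
have [|mu [U [V [N' [mu_gt0 UU VU E]]]]] := @dual_svd_peel_appreciable _ _ N.
  by rewrite stmx_dmx; apply: contraNneq Mn0 => M1; rewrite -[M]dmx_eta M0 M1 dmx0.
exists (eps * mu), U, V, (dq_of_dual eps *: N'); split=> //.
  by rewrite /dual_gt /= mul0r mul1r mul0r add0r eqxx mu_gt0 orbT.
rewrite MN (scale_mulmxr (dq_of_dualP _)) -scalemxAl E scale_block_mx !scaler0.
by rewrite dq_of_dualM scale_scalar_mx.
Qed.
End DualSVD.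

(** * Unitary equivalence and the sorting of singular values *)

Section UnitaryEquivalence.
Variables (T : nzRingType) (f : involution T).
Implicit Types m n : nat.

Definition unitary_equiv m n (M N : 'M[T]_(m, n)) :=
  exists U V, [/\ unitary f U, unitary f V & star f U *m M *m V = N].

Lemma unitary_equiv_refl m n (M : 'M[T]_(m, n)) : unitary_equiv M M.
Proof.
exists 1%:M, 1%:M; split; [exact: unitary1 | exact: unitary1 | ].
by rewrite star1 mul1mx mulmx1.
Qed.

Lemma unitary_equiv_trans m n (N M L : 'M[T]_(m, n)) :
  unitary_equiv M N -> unitary_equiv N L -> unitary_equiv M L.
Proof.
move=> [U [V [UU VU <-]]] [U' [V' [UU' VU' <-]]].
exists (U *m U'), (V *m V'); split; [exact: unitaryM | exact: unitaryM | ].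
by rewrite starM !mulmxA.
Qed.

Lemma unitary_equiv_block m n m' n' (L : 'M[T]_(m', n')) (M N : 'M[T]_(m, n)) :
  unitary_equiv M N -> unitary_equiv (block_mx L 0 0 M) (block_mx L 0 0 N).
Proof.
move=> [U [V [UU VU <-]]].
exists (block_mx 1%:M 0 0 U), (block_mx 1%:M 0 0 V).
split; [exact: unitary_block (unitary1 _ _) UU | exact: unitary_block (unitary1 _ _) VU | ].
rewrite star_block star1 !star0 !mulmx_block.
by rewrite !(mulmx0, mul0mx, addr0, add0r, mul1mx, mulmx1).
Qed.

End UnitaryEquivalence.

Section DualSVD.
Variable R : realType.
Local Notation dq_equiv := (unitary_equiv (dq_involution R)).
Implicit Types m n : nat.
Implicit Types s t : seq (dualnum R).

(** Indices past the end of [s] read the default [0], so the zero blocks of the singular value form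
    are covered by the same formula, without casts. *)
Definition rect_diag m n s : 'M[dualquat R]_(m, n) :=
  \matrix_(a, b) if (a : nat) == b then dq_of_dual (nth 0 s a) else 0.

Lemma dq_of_dual0 : dq_of_dual 0 = 0 :> dualquat R.
Proof. by []. Qed.

Lemma rect_diag_nil m n : rect_diag m n [::] = 0.
Proof. by apply/matrixP => a b; rewrite !mxE nth_nil dq_of_dual0 if_same. Qed.

Lemma rect_diag_cat m n s t :
  rect_diag (size s + m) (size s + n) (s ++ t) =
  block_mx (sigma_mx s) 0 0 (rect_diag m n t).
Proof.
apply/matrixP => a b; rewrite -[a]splitK -[b]splitK.
case: (split a) => c; case: (split b) => d /=.
- by rewrite block_mxEul !mxE nth_cat /= ltn_ord -val_eqE; case: (val c == val d).
- by rewrite block_mxEur !mxE /= ltn_eqF // ltn_addr.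
- by rewrite block_mxEdl !mxE /= gtn_eqF // ltn_addr.
- by rewrite block_mxEdr !mxE nth_cat /= ltnNge leq_addr /= addKn eqn_add2l.
Qed.

Lemma rect_diag_cons m n x s :
  rect_diag (1 + m) (1 + n) (x :: s) =
  block_mx (dq_of_dual x)%:M 0 0 (rect_diag m n s).
Proof.
apply/matrixP => a b; rewrite -[a]splitK -[b]splitK.
case: (split a) => c; case: (split b) => d /=.
- by rewrite block_mxEul !ord1 !mxE.
- by rewrite block_mxEur !ord1 !mxE.
- by rewrite block_mxEdl !ord1 !mxE.
- by rewrite block_mxEdr !mxE.
Qed.

(** Singular values are peeled off one at a time until what is left vanishes. They come out in no
    prescribed order. *)
Lemma dual_svd_unsorted m n (M : 'M[dualquat R]_(m, n)) : exists s,
  [/\ all (fun x => dual_gt x 0) s, (size s <= minn m n)%N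
    & dq_equiv M (rect_diag m n s)].
Proof.
elim: m n M => [|m IHm] n M.
  exists [::]; split=> //.
  by rewrite (_ : rect_diag _ _ _ = M) ?[RHS]flatmx0 ?[LHS]flatmx0 //; apply: unitary_equiv_refl.
have [M0|M0] := eqVneq M 0.
  by exists [::]; rewrite rect_diag_nil M0; split=> //; apply: unitary_equiv_refl.
case: n => [|n] in M M0 *; first by rewrite [M]thinmx0 eqxx in M0.
have [mu [U [V [M' [mu0 UU VU E]]]]] := @dual_svd_peel _ m n M M0.
have [s [s0 sz Es]] := IHm _ M'.
exists (mu :: s); split; rewrite /= ?mu0 ?s0 ?minnSS ?ltnS //.
have {}E : dq_equiv (M : 'M_(1 + m, 1 + n)) (block_mx (dq_of_dual mu)%:M 0 0 M').
  by exists U, V.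
apply: unitary_equiv_trans E _; rewrite rect_diag_cons.
exact: unitary_equiv_block Es.
Qed.

(** The permutation matrix of the first two coordinates, in the nested block shape in which
    [rect_diag] is peeled. *)
Definition swap_mx (T : nzRingType) k : 'M[T]_(1 + (1 + k)) :=
  block_mx 0 (row_mx 1%:M 0) (col_mx 1%:M 0) (block_mx 0 0 0 1%:M).

Lemma swap_mxM (T : nzRingType) m n (x y : 'M[T]_1) (D : 'M[T]_(m, n)) :
  swap_mx T m *m block_mx x 0 0 (block_mx y 0 0 D) *m swap_mx T n =
  block_mx y 0 0 (block_mx x 0 0 D).
Proof.
have s0 := (mulmx0, mul0mx, addr0, add0r, mul1mx, mulmx1).
rewrite /swap_mx !(mulmx_block, s0) !(mul_row_block, mul_row_col, mul_col_row, mul_block_col, mul_col_mx, mul_mx_row, mulmx_block, s0).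
rewrite row_mx0 col_mx0 -[X in row_mx _ X]col_mx0 -block_mxEh add_block_mx.
by rewrite !addr0 add0r.
Qed.

Lemma swap_mx1 (T : nzRingType) k : swap_mx T k *m swap_mx T k = 1%:M.
Proof.
have := @swap_mxM T k k 1%:M 1%:M 1%:M.
by rewrite -(scalar_mx_block 1 k) -(scalar_mx_block 1 (1 + k)) mulmx1.
Qed.

Lemma star_swap_mx (T : nzRingType) (f : involution T) k :
  star f (swap_mx T k) = swap_mx T k.
Proof. by rewrite /swap_mx !star_block star_row star_col !star0 !star1. Qed.

Lemma rect_diag_swap m n x y s :
  dq_equiv (rect_diag (1 + (1 + m)) (1 + (1 + n)) [:: x, y & s])
    (rect_diag (1 + (1 + m)) (1 + (1 + n)) [:: y, x & s]).
Proof.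
have TU k : dqunitary (swap_mx (dualquat R) k).
  by split; rewrite star_swap_mx swap_mx1.
exists (swap_mx _ m), (swap_mx _ n); split=> //.
by rewrite star_swap_mx !rect_diag_cons swap_mxM.
Qed.

(** Adjacent swaps bubble [x] to the front. The size bounds ensure that every entry of [s] really
    sits on the diagonal. *)
Lemma rect_diag_front m n x s : x \in s -> (size s <= m)%N -> (size s <= n)%N ->
  dq_equiv (rect_diag m n s) (rect_diag m n (x :: rem x s)).
Proof.
elim: s m n => // y s IHs m n; rewrite inE /= eq_sym.
have [<- _ _ _|xy /= xs] := eqVneq y x; first exact: unitary_equiv_refl.
have s_gt0 : (0 < size s)%N by case: (s) xs.
case: m => // m; case: n => // n; rewrite !ltnS => sm sn.
case: m => [|m] in sm *; first by rewrite leqNgt s_gt0 in sm.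
case: n => [|n] in sn *; first by rewrite leqNgt s_gt0 in sn.
apply: unitary_equiv_trans (rect_diag_swap m n y x (rem x s)).
rewrite [X in dq_equiv X]rect_diag_cons [X in dq_equiv _ X]rect_diag_cons.
exact: unitary_equiv_block (IHs _ _ xs sm sn).
Qed.

Lemma rect_diag_perm m n s t : perm_eq s t -> (size s <= m)%N -> (size s <= n)%N ->
  dq_equiv (rect_diag m n s) (rect_diag m n t).
Proof.
elim: t s m n => [|x t IHt] s m n st sm sn.
  by rewrite (perm_small_eq _ st) //; apply: unitary_equiv_refl.
have xs : x \in s by rewrite (perm_mem st) mem_head.
apply: unitary_equiv_trans (rect_diag_front xs sm sn) _.
move: st; rewrite (permPl (perm_to_rem xs)) perm_cons => st.
have sE := perm_size (perm_to_rem xs).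
rewrite sE in sm sn; case: m n sm sn => // m [] // n sm sn.
rewrite [X in dq_equiv X]rect_diag_cons [X in dq_equiv _ X]rect_diag_cons.
exact: (@unitary_equiv_block _ _ m n 1 1 _ _ _ (IHt _ _ _ st sm sn)).
Qed.

Lemma dual_geE (x y : dualnum R) : dual_ge x y =
  (stpart y < stpart x) || (stpart x == stpart y) && (inpart y <= inpart x).
Proof.
case: x y => [a b] [c d]; rewrite /dual_ge /dual_gt /= le_eqVlt.
have -> : (Dual a b == Dual c d) = (a == c) && (b == d).
  by apply/eqP/andP => [[-> ->]|[/eqP-> /eqP->]].
rewrite [a == c]eq_sym [b == d]eq_sym.
by case: (c < a) (c == a) (d == b) (d < b) => [] [] [] [].
Qed.

Lemma dual_ge_total : total (@dual_ge R).
Proof.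
move=> x y; rewrite !dual_geE; case: (ltgtP (stpart x) (stpart y)) => //= _.
exact: le_total.
Qed.

Lemma dual_ge_trans : transitive (@dual_ge R).
Proof.
move=> y x z; rewrite !dual_geE => /orP[xy|/andP[/eqP-> xy]] /orP[yz|/andP[/eqP zy yz]].
- by rewrite (lt_trans yz xy).
- by rewrite -zy xy.
- by rewrite yz.
- by rewrite zy eqxx (le_trans yz xy) orbT.
Qed.

(** A positive dual number below an infinitesimal one is infinitesimal, its standard part being
    squeezed between [0] and [0]. Hence the appreciable entries come first. *)
Lemma sorted_appreciable s : sorted (@dual_ge R) s -> all (fun x => dual_gt x 0) s ->
  s = [seq x <- s | appreciable x] ++ [seq x <- s | infinitesimal x].
Proof.
elim: s => //= x s IHs xs /andP[x0 s0].
have {}IHs := IHs (path_sorted xs) s0.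
have [xi|xa] := boolP (infinitesimal x); last by rewrite [appreciable x]xa /= -IHs.
have -> : appreciable x = false by apply: negbF.
suff sa : [seq y <- s | appreciable y] = [::] by rewrite sa /= [in LHS]IHs sa.
rewrite (eq_in_filter (a2 := pred0)) ?filter_pred0 // => y ys; apply: negbF.
have := allP (order_path_min dual_ge_trans xs) y ys.
have := allP s0 y ys; rewrite dual_geE /dual_gt /= (eqP xi).
by case: (ltgtP (stpart y) 0).
Qed.

Lemma rect_diag_cast m n x y s (e : (size s + x = m)%N * (size s + y = n)%N) :
  castmx e (block_mx (sigma_mx s) 0 0 (0 : 'M_(x, y))) = rect_diag m n s.
Proof.
case: e => e1 e2; case: m / e1; case: n / e2; rewrite castmx_id.
by have := rect_diag_cat x y s [::]; rewrite cats0 rect_diag_nil => ->.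
Qed.

Lemma dual_svd m n (M : 'M[dualquat R]_(m, n)) :
  exists ap im, is_singular_values M ap im.
Proof.
have [s [s0 sz Es]] := dual_svd_unsorted M.
pose t := sort (@dual_ge R) s.
have st : perm_eq s t by rewrite perm_sym perm_sort.
have t0 : all (fun x => dual_gt x 0) t by rewrite -(perm_all _ st).
have ts : sorted (@dual_ge R) t := sort_sorted dual_ge_total _.
have := sorted_appreciable ts t0.
set ap := filter _ t; set im := filter _ t => tE.
exists ap, im; split.
- by rewrite all_filter (sub_all _ t0) ?sorted_filter //=; [exact: dual_ge_trans | move=> y yp; apply/implyP => -> ].
- by rewrite all_filter (sub_all _ t0) ?sorted_filter //=; [exact: dual_ge_trans | move=> y yp; apply/implyP => -> ].
- by rewrite -tE -(perm_size st).
have := sz; rewrite leq_min => /andP[sm sn].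
have [U [V [UU VU E]]] := unitary_equiv_trans Es (rect_diag_perm st sm sn).
rewrite -tE (perm_size st) in sz sm sn *.
exists U, V; split=> //; exists (subnKC sm, subnKC sn).
by rewrite rect_diag_cast.
Qed.
End DualSVD.

(** * Equivalence of triples of matrices *)

Section TripleEquivalence.
Variables (T : nzRingType) (f : involution T).
Implicit Types m n p q r : nat.

Lemma is_inverse1 n : is_inverse (1%:M : 'M[T]_n) 1%:M.
Proof. by split; rewrite mulmx1. Qed.

Lemma is_inverse_unitary n (U : 'M[T]_n) : unitary f U -> is_inverse U (star f U).
Proof. by case. Qed.

Lemma is_inverseM n (P P' Q Q' : 'M[T]_n) :
  is_inverse P P' -> is_inverse Q Q' -> is_inverse (P *m Q) (Q' *m P').
Proof.
move=> [P1 P2] [Q1 Q2]; split.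
  by rewrite mulmxA -(mulmxA P) Q1 mulmx1.
by rewrite mulmxA -(mulmxA Q') P2 mulmx1.
Qed.

Lemma is_inverse_tri m n (P P' : 'M[T]_m) (Q Q' : 'M[T]_n) (L : 'M[T]_(n, m)) :
  is_inverse P P' -> is_inverse Q Q' ->
  is_inverse (block_mx P 0 L Q) (block_mx P' 0 (- (Q' *m L *m P')) Q').
Proof.
move=> [P1 P2] [Q1 Q2]; split; rewrite mulmx_block !(mulmx0, mul0mx, addr0, add0r).
  by rewrite mulmxN !mulmxA Q1 mul1mx subrr P1 -scalar_mx_block.
by rewrite mulNmx -!mulmxA P2 mulmx1 addNr Q2 -scalar_mx_block.
Qed.

Lemma is_inverse_diag m n (P P' : 'M[T]_m) (Q Q' : 'M[T]_n) :
  is_inverse P P' -> is_inverse Q Q' ->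
  is_inverse (block_mx P 0 0 Q) (block_mx P' 0 0 Q').
Proof.
by move=> PP QQ; have := is_inverse_tri 0 PP QQ; rewrite mulmx0 mul0mx oppr0.
Qed.

(** The outer changes of basis are unitary and the two inner ones merely invertible, so the product
    [A B C] changes by a unitary equivalence. *)
Definition triple_equiv m n p q
    (A : 'M[T]_(m, n)) (B : 'M[T]_(n, p)) (C : 'M[T]_(p, q)) A1 B1 C1 :=
  exists U V P P' Q Q', [/\ unitary f U, unitary f V, is_inverse P P', is_inverse Q Q'
    & [/\ star f U *m A *m P = A1, P' *m B *m Q = B1 & Q' *m C *m V = C1]].

Lemma triple_equiv_trans m n p q A1 B1 C1
    (A A2 : 'M[T]_(m, n)) (B B2 : 'M[T]_(n, p)) (C C2 : 'M[T]_(p, q)) :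
  triple_equiv A B C A1 B1 C1 -> triple_equiv A1 B1 C1 A2 B2 C2 ->
  triple_equiv A B C A2 B2 C2.
Proof.
move=> [U [V [P [P' [Q [Q' [U1 V1 P1 Q1 [<- <- <-]]]]]]]].
move=> [X [Y [S [S' [Z [Z' [X1 Y1 S1 Z1 [<- <- <-]]]]]]]].
exists (U *m X), (V *m Y), (P *m S), (S' *m P'), (Q *m Z), (Z' *m Q').
split; [exact: unitaryM | exact: unitaryM | exact: is_inverseM | exact: is_inverseM |].
by rewrite starM !mulmxA.
Qed.

Lemma triple_equiv_block r m n p q (D : 'M[T]_r)
    (A A1 : 'M[T]_(m, n)) (B B1 : 'M[T]_(n, p)) (C C1 : 'M[T]_(p, q)) :
  triple_equiv A B C A1 B1 C1 ->
  triple_equiv (block_mx 1%:M 0 0 A) (block_mx 1%:M 0 0 B) (block_mx D 0 0 C)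
    (block_mx 1%:M 0 0 A1) (block_mx 1%:M 0 0 B1) (block_mx D 0 0 C1).
Proof.
move=> [U [V [P [P' [Q [Q' [U1 V1 P1 Q1 [<- <- <-]]]]]]]].
have I := is_inverse1 r; have J := unitary1 f r.
exists (block_mx 1%:M 0 0 U), (block_mx 1%:M 0 0 V), (block_mx 1%:M 0 0 P),
  (block_mx 1%:M 0 0 P'), (block_mx 1%:M 0 0 Q), (block_mx 1%:M 0 0 Q').
split; [exact: unitary_block | exact: unitary_block | exact: is_inverse_diag
  | exact: is_inverse_diag |].
rewrite star_block star1 !star0 !mulmx_block.
by rewrite !(mulmx0, mul0mx, addr0, add0r, mul1mx, mulmx1).
Qed.

Lemma triple_equiv_prod m n p q
    (A A1 : 'M[T]_(m, n)) (B B1 : 'M[T]_(n, p)) (C C1 : 'M[T]_(p, q)) :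
  triple_equiv A B C A1 B1 C1 -> A *m B *m C = 0 -> A1 *m B1 *m C1 = 0.
Proof.
move=> [U [V [P [P' [Q [Q' [U1 V1 [P1 _] [Q1 _] [<- <- <-]]]]]]]] ABC.
rewrite !mulmxA -(mulmxA _ P) P1 mulmx1 -(mulmxA _ Q) Q1 mulmx1 -!(mulmxA _ A).
by rewrite -(mulmxA _ _ C) ABC mulmx0 mul0mx.
Qed.

(** The columns of [Ub] are orthogonal to those of [X]. Projecting them along [X] onto the kernel of
    [F] gives the missing columns [(1 - X F) Ub], and [star f Ub] gives the missing rows. *)
Lemma complete_left_inverse r n0 n (F : 'M[T]_(r, n)) (X : 'M[T]_(n, r))
    (Ua : 'M[T]_(n, r)) (Ub : 'M[T]_(n, n0)) (Z : 'M[T]_r) :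
  F *m X = 1%:M -> Ua = X *m Z -> star f Ub *m X = 0 ->
  star f (row_mx Ua Ub) *m row_mx Ua Ub = 1%:M ->
  row_mx Ua Ub *m star f (row_mx Ua Ub) = 1%:M ->
  exists (X' : 'M[T]_(n, n0)) (F' : 'M[T]_(n0, n)),
    col_mx F F' *m row_mx X X' = 1%:M /\ row_mx X X' *m col_mx F F' = 1%:M.
Proof.
move=> FX UaE UbX /unitary_rowP[_ _ _ UbUb]; rewrite star_row mul_row_col => UU.
exists ((1%:M - X *m F) *m Ub), (star f Ub); split.
  rewrite mul_col_row FX UbX mulmxA mulmxBr mulmx1 mulmxA FX mul1mx subrr mul0mx.
  by rewrite mulmxA mulmxBr mulmx1 mulmxA UbX mul0mx subr0 UbUb -scalar_mx_block.
rewrite mul_row_col -mulmxA.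
have -> : Ub *m star f Ub = 1%:M - Ua *m star f Ua by rewrite -UU addrC addKr.
rewrite mulmxBr mulmx1 mulmxA mulmxBl mul1mx UaE mulmxA -(mulmxA X F X) FX mulmx1.
by rewrite subrr mul0mx subr0 addrC subrK.
Qed.

(** The rows [A1] and [A1 B] are the coordinate functions of [X] and [Y], which makes all three
    matrices block diagonal. The product of the second blocks is computed from [X' F' = 1 - X A1]
    and [Y' G' = 1 - Y A1 B], whose corrections vanish because [A2 X = 0] and [A1 B C2 = 0]. *)
Lemma split_off_invertible r m0 n0 p0 n p q0 (A1 : 'M[T]_(r, n)) (A2 : 'M[T]_(m0, n))
    (B : 'M[T]_(n, p)) (C1 : 'M[T]_(p, r)) (C2 : 'M[T]_(p, q0)) (S S' : 'M[T]_r)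
    (X' : 'M[T]_(n, n0)) (F' : 'M[T]_(n0, n)) (Y' : 'M[T]_(p, p0)) (G' : 'M[T]_(p0, p)) :
  is_inverse S S' -> A1 *m B *m C1 = S -> A1 *m B *m C2 = 0 -> A2 *m B *m C1 = 0 ->
  let Y := C1 *m S' in let X := B *m Y in
  col_mx A1 F' *m row_mx X X' = 1%:M -> row_mx X X' *m col_mx A1 F' = 1%:M ->
  col_mx (A1 *m B) G' *m row_mx Y Y' = 1%:M -> row_mx Y Y' *m col_mx (A1 *m B) G' = 1%:M ->
  [/\ col_mx A1 A2 *m row_mx X X' = block_mx 1%:M 0 0 (A2 *m X'),
      col_mx A1 F' *m B *m row_mx Y Y' = block_mx 1%:M 0 0 (F' *m B *m Y'),
      col_mx (A1 *m B) G' *m row_mx C1 C2 = block_mx S 0 0 (G' *m C2)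
    & (A2 *m X') *m (F' *m B *m Y') *m (G' *m C2) = A2 *m B *m C2].
Proof.
move=> [SS' S'S] ABC1 ABC2 A2BC1 Y X.
move=> PP XE QQ YE; rewrite mul_row_col in XE; rewrite mul_row_col in YE.
rewrite mul_col_row (scalar_mx_block r n0) in PP.
rewrite mul_col_row (scalar_mx_block r p0) in QQ.
have [A1X A1X' F'X F'X'] := eq_block_mx PP.
have [ABY ABY' G'Y G'Y'] := eq_block_mx QQ.
have C1Y : C1 = Y *m S by rewrite /Y -mulmxA S'S mulmx1.
have A2X : A2 *m X = 0 by rewrite /X /Y !mulmxA A2BC1 mul0mx.
split.
- by rewrite mul_col_row A1X A1X' A2X.
- by rewrite mul_col_mx mul_col_row ABY ABY' -(mulmxA F' B Y) -/X F'X.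
- by rewrite mul_col_row ABC1 ABC2 {1}C1Y mulmxA G'Y mul0mx.
have XF : X' *m F' = 1%:M - X *m A1 by rewrite -XE addrC addKr.
have YG : Y' *m G' = 1%:M - Y *m (A1 *m B) by rewrite -YE addrC addKr.
rewrite !mulmxA -(mulmxA A2 X') XF mulmxBr mulmx1 mulmxA A2X mul0mx subr0.
rewrite -(mulmxA (A2 *m B)) YG mulmxBr mulmx1 mulmxBl -(mulmxA _ (Y *m _)).
by rewrite -(mulmxA Y) ABC2 !mulmx0 subr0.
Qed.
End TripleEquivalence.

(* An SVD of the quaternion matrix [A] is read off the standard part of a dual one;
   [V] is then rescaled by the inverse singular values. *)
Lemma quat_rank_form (R : realType) m n (A : 'M[quat R]_(m, n)) :
  exists i (U : 'M[quat R]_m) (P P' : 'M[quat R]_n),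
    [/\ (i <= m)%N, (i <= n)%N, qunitary U, is_inverse P P'
      & qstar U *m A *m P = pid_mx i].
Proof.
have [ap [im [/andP[ap0 _] /andP[im0 _] sz]]] := dual_svd (dmx A 0).
move=> [U [V [UU VU E]]]; move: sz; rewrite leq_min => /andP[sm sn].
have {E} : dqstar U *m dmx A 0 *m V = rect_diag m n (ap ++ im).
  by case: E => e ->; apply: rect_diag_cast.
move=> /(congr1 (@stmx _ _ _)); rewrite !stmxM stmx_star stmx_dmx => E.
have [V1 V2] := unitary_stmx VU; have {}UU := unitary_stmx UU.
pose s b := stpart (nth 0 (ap ++ im) b).
have s0 b : (b < size ap)%N -> s b != 0.
  move=> b_lt; rewrite /s nth_cat b_lt.
  by have /andP[] := allP ap0 _ (mem_nth 0 b_lt).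
have s1 b : (size ap <= b)%N -> s b = 0.
  move=> b_ge; rewrite /s nth_cat ltnNge b_ge /=.
  have [b_lt|/(nth_default 0)->//] := ltnP (b - size ap) (size im).
  by have /andP[/eqP] := allP im0 _ (mem_nth 0 b_lt).
(* [D g] applies [g] to the nonzero singular values and is the identity beyond them. [D GRing.inv]
   scales those values to [1], and [D id] is its inverse. *)
pose D (g : R -> R) : 'M[quat R]_n :=
  diag_mx (\row_b if (b < size ap)%N then real_quat (g (s b)) else 1).
have DD g h : (forall x, x != 0 -> g x * h x = 1) -> D g *m D h = 1%:M.
  move=> gh; rewrite /D mulmx_diag -diag_const_mx; congr diag_mx.
  apply/rowP => b; rewrite !mxE; case: ifP => [/s0 sb|_]; last by rewrite mulr1.
  by rewrite -real_quatM gh.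
rewrite size_cat in sm sn.
exists (size ap), (stmx U), (stmx V *m D GRing.inv), (D id *m qstar (stmx V)).
split; [exact: leq_trans (leq_addr _ _) sm | exact: leq_trans (leq_addr _ _) sn
  | exact: UU | |].
  apply: is_inverseM; first by split.
  by split; apply: DD => x x0; rewrite ?mulVf ?mulfV.
rewrite mulmxA E mul_mx_diag; apply/matrixP => a b; rewrite !mxE.
have [->|_] := eqVneq (a : nat) b; last by rewrite mul0r.
rewrite /= -/(s b); case: ltnP => [/s0 sb|/s1->]; last by rewrite mulr1.
by rewrite -real_quatM mulfV.
Qed.

(** The rank form of the adjoint, read backwards: here the right-hand factor is the unitary one, as
    suits [C]. *)
Lemma quat_rank_form_adj (R : realType) m n (A : 'M[quat R]_(m, n)) :
  exists i (P P' : 'M[quat R]_m) (V : 'M[quat R]_n),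
    [/\ (i <= m)%N, (i <= n)%N, is_inverse P P', qunitary V & P' *m A *m V = pid_mx i].
Proof.
have [i [U [P [P' [im_ in_ UU [P1 P2] E]]]]] := quat_rank_form (qstar A).
exists i, (qstar P'), (qstar P), U; split=> //.
  by split; rewrite -starM ?P1 ?P2 star1.
have := congr1 (fun X => qstar X) E; rewrite !starM !starK mulmxA => ->.
apply/matrixP => a b; rewrite !mxE eq_sym.
have [->|_] := eqVneq (a : nat) b; last exact: quat_conj0.
by rewrite /=; case: (_ < i)%N => /=; rewrite ?quat_conj0 ?quat_conj1.
Qed.

(** In an SVD of [X] the equation [F X = 1] makes the square diagonal part [S] invertible. The first
    columns of [U] are then [X V S^-1] and the others are orthogonal to [X], as
    [complete_left_inverse] requires. *)
Lemma dual_completion (R : realType) r n (F : 'M[dualquat R]_(r, n)) X :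
  F *m X = 1%:M -> exists n0 (X' : 'M[dualquat R]_(n, n0)) (F' : 'M[dualquat R]_(n0, n)),
    [/\ (r + n0 = n)%N, col_mx F F' *m row_mx X X' = 1%:M
      & row_mx X X' *m col_mx F F' = 1%:M].
Proof.
move=> FX; have [s [_ _ [U [V [UU VU E]]]]] := dual_svd_unsorted X.
have [V1 V2] := VU; have [U1 U2] := UU.
have GD : dqstar V *m F *m U *m rect_diag n r s = 1%:M.
  rewrite -E !mulmxA -(mulmxA _ U) U2 mulmx1 -(mulmxA _ F) FX mulmx1 V1 //.
have rn : (r <= n)%N.
  (* If [n < r], the column of index [n] of [rect_diag n r s] is zero, whereas the diagonal entry
     there should be [1]. *)
  rewrite leqNgt; apply/negP => nr; have /matrixP/(_ (Ordinal nr) (Ordinal nr)) := GD.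
  rewrite mxE big1 => [|k _]; last by rewrite !mxE /= ltn_eqF ?mulr0.
  by move/eqP; rewrite mxE eqxx eq_sym oner_eq0.
have [n0 ne] : exists n0, n = (r + n0)%N by exists (n - r)%N; rewrite subnKC.
subst n; exists n0.
have DE : rect_diag (r + n0) r s = col_mx (rect_diag r r s) 0.
  apply/matrixP => a b; rewrite !mxE; case: splitP => k ak; rewrite !mxE ak //.
  by rewrite gtn_eqF // ltn_addr.
pose S := rect_diag r r s; have [Z ZS] : exists Z, Z *m S = 1%:M.
  move: GD; move: (dqstar V *m F *m U) => H; rewrite DE -[H]hsubmxK mul_row_col.
  by rewrite mulmx0 addr0; exists (lsubmx H).
pose t b := nth 0 s b; pose z b := Z b b.
have SE : S = diag_mx (\row_b dq_of_dual (t b)).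
  apply/matrixP => a b; rewrite !mxE -val_eqE /=.
  by case: (_ == _).
have zt b : z b * dq_of_dual (t b) = 1.
  by move/matrixP/(_ b b): ZS; rewrite SE mul_mx_diag !mxE eqxx => zt; exact: zt.
(* So far [Z] is only a left inverse. The entries of [S] are central, so the diagonal of [Z] is a
   right inverse of [S], and thus equals [Z]. *)
have SZ : S *m Z = 1%:M.
  have Sz : S *m diag_mx (\row_b z b) = 1%:M.
    rewrite SE mulmx_diag -diag_const_mx; congr diag_mx; apply/rowP => b.
    by rewrite [LHS]mxE [RHS]mxE [X in X * _]mxE [X in _ * X]mxE (dq_of_dualP _).1 zt.
  suff -> : Z = diag_mx (\row_b z b) by [].
  by rewrite -[LHS]mulmx1 -Sz mulmxA ZS mul1mx.
move: (U1) (U2); rewrite -[U]hsubmxK; set Ua := lsubmx U; set Ub := rsubmx U => Ub1 Ub2.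
have XV : X *m V = Ua *m S.
  have : U *m (dqstar U *m X *m V) = U *m rect_diag (r + n0) r s by rewrite E.
  by rewrite !mulmxA U2 mul1mx DE -[U in RHS]hsubmxK mul_row_col mulmx0 addr0.
have [_ _ UbUa _] := unitary_rowP Ub1.
have [||X' [F' [E1 E2]]] := @complete_left_inverse _ (dq_involution R) _ _ _ F X Ua Ub (V *m Z) FX _ _ Ub1 Ub2.
- by rewrite mulmxA XV -mulmxA SZ mulmx1.
- by rewrite -[X]mulmx1 -V2 (mulmxA X) XV !mulmxA UbUa !mul0mx.
exists X', F'; split; [exact: erefl | exact: E1 | exact: E2].
Qed.

(** * Normal form of a quaternion triple with zero product *)

Section StandardTriple.
Variables (T : nzRingType) (f : involution T).

(** These three are the standard parts of the target forms, once [Sigma] has been split off.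
    Independent sizes such as [i'] stand for differences such as [i - j], so that the blocks fit
    without casts. *)
Definition std_A i m n : 'M[T]_(i + m, i + n) := block_mx 1%:M 0 0 0.

Definition std_B j i' k n p : 'M[T]_((j + i') + (k + n), j + (k + p)) :=
  block_mx (col_mx 1%:M 0) 0 0 (block_mx 1%:M 0 0 0).

Definition std_C j s k' t p q : 'M[T]_(j + ((s + k') + (t + p)), s + (t + q)) :=
  col_mx 0 (col_mx (block_mx 1%:M 0 0 0) (row_mx 0 (block_mx 1%:M 0 0 0))).

Let s0 := (mulmx0, mul0mx, addr0, add0r, mul1mx, mulmx1).

(** A change [U] of the first inner coordinates is matched by the same change on the rows of [A],
    hence must be unitary. The block [L] clears what lies below the new identity of [B]; in [A] it
    meets only zero columns. *)
Lemma triple_step_top j i' m n p q (Bt : 'M[T]_(j + i', j + p)) (Bb : 'M[T]_(n, j + p))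
    (C : 'M[T]_(j + p, q)) U Q Q' :
  unitary f U -> is_inverse Q Q' -> star f U *m Bt *m Q = block_mx 1%:M 0 0 0 ->
  exists B1 C1, triple_equiv f (std_A (j + i') m n) (col_mx Bt Bb) C
    (std_A (j + i') m n) (block_mx (col_mx 1%:M 0) 0 0 B1) C1.
Proof.
move=> UU QQ E.
have [H1 [H2 H12]] : exists H1 H2, Bb *m Q = row_mx H1 H2.
  by exists (lsubmx (Bb *m Q)), (rsubmx (Bb *m Q)); rewrite hsubmxK.
pose L : 'M[T]_(n, j + i') := row_mx H1 0.
have PP := is_inverse_tri L (is_inverse_unitary UU) (is_inverse1 T n).
exists H2, (Q' *m C).
exists (block_mx U 0 0 1%:M), 1%:M, (block_mx U 0 L 1%:M).
exists (block_mx (star f U) 0 (- (1%:M *m L *m star f U)) 1%:M), Q, Q'.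
split=> //; [exact: unitary_block UU (unitary1 _ _) | exact: unitary1 | split].
- by rewrite /std_A star_block star1 !star0 !mulmx_block !s0 UU.1.
- rewrite mul_block_col !s0 mul_col_mx E mulmxDl mulNmx mulNmx -!mulmxA (mulmxA _ Bt) E.
  rewrite H12 /L.
  rewrite mul_row_block !s0 opp_row_mx oppr0 add_row_mx addNr add0r.
  by rewrite [RHS]block_mxEv block_mxEh col_mx0.
- by rewrite mulmx1.
Qed.

(** The last [n] inner coordinates meet zero columns of [A], so any invertible [P] may act on
    them. *)
Lemma triple_step_bottom i a m n p j q (E : 'M[T]_(i + a, j)) (B : 'M[T]_(n, p))
    (C : 'M[T]_(j + p, q)) P P' Q Q' :
  is_inverse P P' -> is_inverse Q Q' ->
  exists C1, triple_equiv f (std_A (i + a) m n) (block_mx E 0 0 B) C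
    (std_A (i + a) m n) (block_mx E 0 0 (P' *m B *m Q)) C1.
Proof.
move=> PP QQ; exists (block_mx 1%:M 0 0 Q' *m C).
exists 1%:M, 1%:M, (block_mx 1%:M 0 0 P), (block_mx 1%:M 0 0 P').
exists (block_mx 1%:M 0 0 Q), (block_mx 1%:M 0 0 Q').
split; [exact: unitary1 | exact: unitary1 | exact: is_inverse_diag (is_inverse1 _ _) PP
  | exact: is_inverse_diag (is_inverse1 _ _) QQ | split].
- by rewrite /std_A star1 mul1mx mulmx_block !s0.
- by rewrite !mulmx_block !s0.
- by rewrite mulmx1.
Qed.

(** The change [Y] of the rows of [C2] would disturb the second identity of [B]; the same change in
    [P] restores it, where [A] has zero columns. The block [L] clears what lies below the new
    identity of [C] and meets only zero columns of [B]. *)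
Lemma triple_step_middle j i' m s k' n p q (C2 : 'M[T]_(s + k', s + q))
    (C3 : 'M[T]_(p, s + q)) Y Y' V :
  is_inverse Y Y' -> unitary f V -> Y' *m C2 *m V = block_mx 1%:M 0 0 0 ->
  exists C4, triple_equiv f (std_A (j + i') m ((s + k') + n)) (std_B j i' (s + k') n p)
    (col_mx 0 (col_mx C2 C3))
    (std_A (j + i') m ((s + k') + n)) (std_B j i' (s + k') n p)
    (col_mx 0 (col_mx (block_mx 1%:M 0 0 0) (row_mx 0 C4))).
Proof.
move=> YY VV E.
have [H1 [H2 H12]] : exists H1 H2, C3 *m V = row_mx H1 H2.
  by exists (lsubmx (C3 *m V)), (rsubmx (C3 *m V)); rewrite hsubmxK.
pose L : 'M[T]_(p, s + k') := row_mx H1 0.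
have QQ := is_inverse_tri L YY (is_inverse1 T p).
exists H2.
exists 1%:M, V, (block_mx 1%:M 0 0 (block_mx Y 0 0 1%:M)), (block_mx 1%:M 0 0 (block_mx Y' 0 0 1%:M)).
exists (block_mx 1%:M 0 0 (block_mx Y 0 L 1%:M)).
exists (block_mx 1%:M 0 0 (block_mx Y' 0 (- (1%:M *m L *m Y')) 1%:M)).
have I1 k := is_inverse1 T k.
split; [exact: unitary1 | exact: VV | by apply: is_inverse_diag => //; apply: is_inverse_diag
  | exact: is_inverse_diag | split].
- by rewrite /std_A star1 mul1mx mulmx_block !s0.
- by rewrite /std_B !(mulmx_block, s0) YY.2.
- rewrite mul_block_col !s0 mul_block_col !s0 !mul_col_mx mul0mx E.
  rewrite mulmxDl mulNmx mulNmx -!mulmxA (mulmxA _ C2) E.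
  rewrite H12 /L.
  by rewrite mul_row_block !s0 opp_row_mx oppr0 add_row_mx addNr add0r.
Qed.

(** The rows of [C4] face zero columns of [B], so [Y] may act on them freely. *)
Lemma triple_step_last j i' m s k' n t p q (C4 : 'M[T]_(t + p, t + q)) Y Y' V :
  is_inverse Y Y' -> unitary f V -> Y' *m C4 *m V = block_mx 1%:M 0 0 0 ->
  triple_equiv f (std_A (j + i') m ((s + k') + n)) (std_B j i' (s + k') n (t + p))
    (col_mx 0 (col_mx (block_mx 1%:M 0 0 0) (row_mx 0 C4)))
    (std_A (j + i') m ((s + k') + n)) (std_B j i' (s + k') n (t + p))
    (std_C j s k' t p q).
Proof.
move=> YY VV E; have I1 k := is_inverse1 T k.
exists 1%:M, (block_mx 1%:M 0 0 V), 1%:M, 1%:M.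
exists (block_mx 1%:M 0 0 (block_mx 1%:M 0 0 Y)), (block_mx 1%:M 0 0 (block_mx 1%:M 0 0 Y')).
split; [exact: unitary1 | exact: unitary_block (unitary1 _ _) VV | exact: I1
  | by apply: is_inverse_diag => //; apply: is_inverse_diag | split].
- by rewrite star1 mulmx1 mul1mx.
- by rewrite /std_B mul1mx !mulmx_block !s0.
- rewrite /std_C mul_block_col !s0 mul_block_col !s0 !mul_col_mx mul0mx.
  by rewrite !(mulmx_block, mul_mx_row, mul_row_block, s0) E.
Qed.
End StandardTriple.

Lemma cast_eq_mx_refl (T : Type) m n (A : 'M[T]_(m, n)) : cast_eq_mx A A.
Proof. by exists (erefl, erefl); rewrite castmx_id. Qed.

Lemma cast_eq_mx_eq (T : Type) m n (A B : 'M[T]_(m, n)) : cast_eq_mx A B -> A = B.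
Proof. by case=> e ->; apply/matrixP => a b; rewrite castmxE !cast_ord_id. Qed.

Lemma subnKC_ex i m : (i <= m)%N -> exists m', m = (i + m')%N.
Proof. by move=> im; exists (m - i)%N; rewrite subnKC. Qed.

(** Five rank decompositions in turn: of [A], of the top rows of [B], of what is left of its bottom
    rows, of the rows of [C] that face the second identity of [B], and of what is left of its last
    rows. *)
Lemma quat_triple_form (R : realType) m n p q (A : 'M[quat R]_(m, n))
    (B : 'M[quat R]_(n, p)) (C : 'M[quat R]_(p, q)) : A *m B *m C = 0 ->
  exists j i' m' s k' n' t p' q' A1 B1 C1,
    [/\ triple_equiv (quat_involution R) A B C A1 B1 C1,
        cast_eq_mx A1 (std_A (quat R) (j + i') m' ((s + k') + n')),
        cast_eq_mx B1 (std_B (quat R) j i' (s + k') n' (t + p'))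
      & cast_eq_mx C1 (std_C (quat R) j s k' t p' q')].
Proof.
move=> ABC; have [i [U [P [P' [im in_ UU PP E]]]]] := quat_rank_form A.
have [m' mE] := subnKC_ex im; have [n1 nE] := subnKC_ex in_; subst m n.
rewrite pid_mx_block in E.
have [Bt [Bb E1]] : exists Bt Bb,
    triple_equiv (quat_involution R) A B C (std_A _ i m' n1) (col_mx Bt Bb) C.
  exists (usubmx (P' *m B)), (dsubmx (P' *m B)), U, 1%:M, P, P', 1%:M, 1%:M.
  have I1 := is_inverse1 (quat R) p; have V1 := unitary1 (quat_involution R) q.
  split; [exact: UU | exact: V1 | exact: PP | exact: I1 | ].
  by rewrite vsubmxK !mulmx1 mul1mx.
have [j [U2 [Q [Q' [ji jp UU2 QQ E2]]]]] := quat_rank_form Bt.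
have [i' iE] := subnKC_ex ji; have [p1 pE] := subnKC_ex jp; subst i p.
rewrite pid_mx_block in E2.
have [B2 [C1 {}E2]] := triple_step_top m' Bb C UU2 QQ E2.
have {U U2 UU UU2 P P' PP E im in_ Q Q' QQ} E3 := triple_equiv_trans E1 E2.
have [k [U [Q [Q' [kn kp UU QQ E4]]]]] := quat_rank_form B2.
have [n' nE] := subnKC_ex kn; have [p2 pE] := subnKC_ex kp; subst n1 p1.
rewrite pid_mx_block in E4.
have [C2 {}E2] := triple_step_bottom (quat_involution R) m' (col_mx 1%:M 0 : 'M_(j + i', j))
  B2 C1 (is_inverse_unitary UU) QQ.
rewrite E4 in E2; have {E1 E4 U UU Q Q' QQ kn kp ji jp} E3 := triple_equiv_trans E3 E2.
have [Ca [Cb C2E]] : exists Ca Cb, C2 = col_mx Ca Cb.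
  by exists (usubmx C2), (dsubmx C2); rewrite vsubmxK.
(* With [A] and [B] in normal form, the first [j] rows of [A B C] are those of [C]. *)
have Ca0 : Ca = 0.
  have := triple_equiv_prod E3 ABC; rewrite /std_A C2E !mulmx_block mul_block_col.
  rewrite !(mulmx0, mul0mx, addr0, add0r, mul1mx) mul_col_mx mul1mx mul0mx.
  by rewrite -[X in _ = X]col_mx0 => /eq_col_mx[+ _]; rewrite -[X in _ = X]col_mx0 => /eq_col_mx[].
have [C3 [C4 CbE]] : exists C3 C4, Cb = col_mx C3 C4.
  by exists (usubmx Cb), (dsubmx Cb); rewrite vsubmxK.
have [s [P [P' [V [sk sq PP VV E4]]]]] := quat_rank_form_adj C3.
have [k' kE] := subnKC_ex sk; have [q1 qE] := subnKC_ex sq; subst k q.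
rewrite pid_mx_block in E4.
have [C5 {E4}E4] := triple_step_middle j i' m' n' C4 PP VV E4.
rewrite C2E Ca0 CbE in E3; have {}E3 := triple_equiv_trans E3 E4.
have [t [Q [Q' [W [tp tq QQ WW E5]]]]] := quat_rank_form_adj C5.
have [p' pE] := subnKC_ex tp; have [q' qE] := subnKC_ex tq; subst p2 q1.
rewrite pid_mx_block in E5.
have {}E5 := triple_step_last j i' m' s k' n' QQ WW E5.
exists j, i', m', s, k', n', t, p', q'.
exists (std_A _ (j + i') m' ((s + k') + n')), (std_B _ j i' (s + k') n' (t + p')),
  (std_C _ j s k' t p' q').
split; [exact: triple_equiv_trans E3 E5 | exact: cast_eq_mx_refl
  | exact: cast_eq_mx_refl | exact: cast_eq_mx_refl].
Qed.

(* The infinitesimal parts of [A], [B], [C] are cleared up to the stated blocks by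
   [U = 1 + eps K], [P = 1 + eps L], [Q = 1 + eps M]. *)
Lemma std_infinitesimal_reduction (T : nzRingType) (f : involution T) j i' m' s k' n' t p' q'
    (A : 'M[T]_((j + i') + m', (j + i') + ((s + k') + n')))
    (B : 'M[T]_((j + i') + ((s + k') + n'), j + ((s + k') + (t + p'))))
    (C : 'M[T]_(j + ((s + k') + (t + p')), s + (t + q'))) :
  let A0 := std_A T (j + i') m' ((s + k') + n') in
  let B0 := std_B T j i' (s + k') n' (t + p') in
  let C0 := std_C T j s k' t p' q' in
  exists K L M a b c d x y z,
    [/\ star f K = - K,
        A - K *m A0 + A0 *m L = block_mx 0 0 0 a,
        B - L *m B0 + B0 *m M = block_mx 0 (col_mx 0 b) 0 (block_mx 0 c 0 d)
      & C - M *m C0 = col_mx x (col_mx (row_mx 0 (row_mx 0 y)) (row_mx 0 (row_mx 0 z)))].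
Proof.
move=> A0 B0 C0; pose s0 := (mulmx0, mul0mx, addr0, add0r, mul1mx, mulmx1, oppr0).
have blockP (m1 m2 n1 n2 : nat) (X : 'M[T]_(m1 + m2, n1 + n2)) :
    exists a b c d, X = block_mx a b c d by exists (ulsubmx X), (ursubmx X), (dlsubmx X), (drsubmx X); rewrite submxK.
have rowP (m1 n1 n2 : nat) (X : 'M[T]_(m1, n1 + n2)) : exists a b, X = row_mx a b
  by exists (lsubmx X), (rsubmx X); rewrite hsubmxK.
have colP (m1 m2 n1 : nat) (X : 'M[T]_(m1 + m2, n1)) : exists a b, X = col_mx a b
  by exists (usubmx X), (dsubmx X); rewrite vsubmxK.
have [a11 [a12 [a21 [a22 ->]]]] := blockP _ _ _ _ A.
have [e11 [e12 [e21 [e22 aE]]]] := blockP _ _ _ _ a11.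
have [b11 [b12 [b21 [b22 ->]]]] := blockP _ _ _ _ B.
have [b1 [b2 ->]] := colP _ _ _ b11; have [c1 [c2 ->]] := colP _ _ _ b12.
have [d33 [d34 [d43 [d44 ->]]]] := blockP _ _ _ _ b22.
have [x1 [xr ->]] := colP _ _ _ C; have [x2 [x3 ->]] := colP _ _ _ xr.
have [y1 [yr ->]] := rowP _ _ _ x2; have [y2 [y3 ->]] := rowP _ _ _ yr.
have [z1 [zr ->]] := rowP _ _ _ x3; have [z2 [z3 ->]] := rowP _ _ _ zr.
(* The top left block of [L] has to be [K11 - a11] to clear [a11]. Its first columns must also
   cancel [b2], which gives the lower left block [h] of [K11]; skewness then dictates the upper
   right one. *)
pose h := b2 + e21; pose K11 := block_mx 0 (- star f h) h 0.
pose L12 := - a12.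
have [g1 [g2 gE]] := colP _ _ _ (L12 *m (block_mx 1%:M 0 0 0 : 'M_((s + k') + n', (s + k') + (t + p')))).
(* These blocks of [M] clear the columns of [C] that contain its two identities. What they add to
   [B] is absorbed by [d33 + M22] in [L] and by the remaining block [d34 + M23]. *)
pose M22 : 'M_(s + k') := row_mx y1 0; pose M23 : 'M_(s + k', t + p') := row_mx y2 0.
pose M32 : 'M_(t + p', s + k') := row_mx z1 0; pose M33 : 'M_(t + p') := row_mx z2 0.
pose K := block_mx K11 (- star f a21) a21 0.
pose L := block_mx (K11 - a11) L12 (row_mx b21 0) (row_mx (col_mx (d33 + M22) d43) 0).
pose M := block_mx (- (b1 + e11)) (g1 - c1) 0 (block_mx M22 M23 M32 M33).
exists K, L, M, a22, (c2 - g2), (d34 + M23), d44.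
exists (x1 - (g1 - c1) *m dsubmx C0), y3, z3; split.
- by rewrite /K /K11 !star_block !starN !starK !star0 !opp_block_mx !oppr0 !opprK.
- rewrite /A0 /std_A /K /L !mulmx_block !s0 opp_block_mx !add_block_mx !s0.
  by rewrite /L12 addrA subrK !subrr.
- have E1 : (K11 - a11) *m col_mx 1%:M 0 = col_mx (- e11) (h - e21).
    by rewrite aE /K11 opp_block_mx add_block_mx mul_block_col !s0.
  have E2 : row_mx (col_mx (d33 + M22) d43) (0 : 'M_(_, n')) *m
      block_mx (1%:M : 'M_(s + k')) 0 0 (0 : 'M_(n', t + p')) = block_mx (d33 + M22) 0 d43 0.
    by rewrite mul_row_block !s0 block_mxEh col_mx0.
  rewrite /B0 /std_B /L /M !mulmx_block !s0 gE mul_row_col mulmx1 mulmx0 addr0.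
  rewrite E1 E2 !mul_col_mx !s0 !opp_block_mx !add_block_mx !opp_col_mx !add_col_mx.
  have E3 : b1 - - e11 - (b1 + e11) = 0 by rewrite opprK subrr.
  have E4 : b2 - (h - e21) = 0 by rewrite /h addrK subrr.
  have E5 : c1 - g1 + (g1 - c1) = 0 by rewrite addrA subrK subrr.
  have E6 : d33 - (d33 + M22) + M22 = 0 by rewrite opprD addrA subrr add0r addNr.
  by rewrite E3 E4 E5 E6 !subrr !subr0 !addr0 col_mx0.
- rewrite /C0 /std_C /M mul_block_col !s0 mul_block_col col_mxKd.
  have E1 u (v : 'M_(u, s)) (w : 'M_(u, t)) :
      row_mx v (0 : 'M_(u, k')) *m block_mx 1%:M 0 0 (0 : 'M_(k', t + q')) +
      row_mx w (0 : 'M_(u, p')) *m row_mx 0 (block_mx 1%:M 0 0 0) = row_mx v (row_mx w 0).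
    by rewrite mul_row_block mul_mx_row mul_row_block !s0 add_row_mx !s0.
  by rewrite !E1 !opp_col_mx !add_col_mx !opp_row_mx !add_row_mx !subrr !subr0.
Qed.

(** * Lifting the normal form to the dual quaternions *)

Section DualTriple.
Variable R : comNzRingType.

Lemma is_inverse_dmx (T : nzRingType) n (P P' : 'M[T]_n) :
  is_inverse P P' -> is_inverse (dmx P 0) (dmx P' 0).
Proof. by move=> [P1 P2]; split; rewrite dmxM ?P1 ?P2 mulmx0 mul0mx addr0 dmx1. Qed.

Lemma is_inverse_dmx1 (T : nzRingType) n (L : 'M[T]_n) :
  is_inverse (dmx 1%:M L) (dmx 1%:M (- L)).
Proof. by split; rewrite dmxM !mulmx1 !mul1mx ?addNr ?addrN dmx1. Qed.

Lemma unitary_dmx0 n (U : 'M[quat R]_n) : qunitary U -> dqunitary (dmx U 0).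
Proof.
by move=> UU; rewrite -(mulmx0 n U); apply: unitary_dmx => //; rewrite star0 oppr0.
Qed.

Lemma triple_equiv_lift m n p q (A : 'M[dualquat R]_(m, n)) (B : 'M[dualquat R]_(n, p))
    (C : 'M[dualquat R]_(p, q)) A0 B0 C0 :
  triple_equiv (quat_involution R) (stmx A) (stmx B) (stmx C) A0 B0 C0 ->
  exists A1 B1 C1, triple_equiv (dq_involution R) A B C (dmx A0 A1) (dmx B0 B1) (dmx C0 C1).
Proof.
move=> [U [V [P [P' [Q [Q' [UU VV PP QQ [A0E B0E C0E]]]]]]]].
pose X := dqstar (dmx U 0) *m A *m dmx P 0; pose Y := dmx P' 0 *m B *m dmx Q 0.
pose Z := dmx Q' 0 *m C *m dmx V 0; exists (inmx X), (inmx Y), (inmx Z).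
exists (dmx U 0), (dmx V 0), (dmx P 0), (dmx P' 0), (dmx Q 0), (dmx Q' 0).
split; [exact: unitary_dmx0 | exact: unitary_dmx0 | exact: is_inverse_dmx | exact: is_inverse_dmx | split].
- by rewrite -[LHS]dmx_eta !stmxM stmx_star !stmx_dmx A0E.
- by rewrite -[LHS]dmx_eta !stmxM !stmx_dmx B0E.
- by rewrite -[LHS]dmx_eta !stmxM !stmx_dmx C0E.
Qed.

(** The factors are [1 + eps K], [1 + eps L] and [1 + eps M], inverted by changing the sign of
    [eps]. As [eps^2 = 0], standard parts are kept and infinitesimal parts are shifted linearly. *)
Lemma triple_equiv_infinitesimal m n p q (A0 A1 : 'M[quat R]_(m, n))
    (B0 B1 : 'M[quat R]_(n, p)) (C0 C1 : 'M[quat R]_(p, q)) K L M :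
  qstar K = - K ->
  triple_equiv (dq_involution R) (dmx A0 A1) (dmx B0 B1) (dmx C0 C1)
    (dmx A0 (A1 - K *m A0 + A0 *m L)) (dmx B0 (B1 - L *m B0 + B0 *m M))
    (dmx C0 (C1 - M *m C0)).
Proof.
move=> KS; exists (dmx 1%:M K), 1%:M, (dmx 1%:M L), (dmx 1%:M (- L)), (dmx 1%:M M), (dmx 1%:M (- M)).
have UK : dqunitary (dmx 1%:M K) by rewrite -[K]mul1mx; apply: unitary_dmx (unitary1 _ _) KS.
split; [exact: UK | exact: unitary1 | exact: is_inverse_dmx1 | exact: is_inverse_dmx1 | split].
- by rewrite star_dmx star1 KS !dmxM !mul1mx !mulmx1 mulNmx addrC.
- by rewrite !dmxM !mul1mx !mulmx1 mulNmx addrC.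
- by rewrite mulmx1 !dmxM !mul1mx mulNmx.
Qed.
End DualTriple.

Lemma dmx_col0 (T : nzRingType) m1 m2 n (A : 'M[T]_(m1, n)) (B : 'M_(m2, n)) :
  dmx (col_mx A B) 0 = col_mx (dmx A 0) (dmx B 0).
Proof. by rewrite -dmx_col col_mx0. Qed.

Lemma epsmx0 (R : comNzRingType) m n : epsmx (0 : 'M[quat R]_(m, n)) = 0.
Proof. by rewrite epsmxE dmx0. Qed.

Lemma epsmx_col0 (R : comNzRingType) m1 m2 n (B : 'M[quat R]_(m2, n)) :
  epsmx (col_mx (0 : 'M_(m1, n)) B) = col_mx 0 (epsmx B).
Proof. by rewrite !epsmxE -(dmx0 _ m1 n) -dmx_col col_mx0. Qed.

Lemma infinitesimal_triple_form (R : realType) m n p q (A : 'M[dualquat R]_(m, n))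
    (B : 'M[dualquat R]_(n, p)) (C : 'M[dualquat R]_(p, q)) : stmx (A *m B *m C) = 0 ->
  exists j i' m' s k' n' t p' q' a b c d x y z A1 B1 C1,
    [/\ triple_equiv (dq_involution R) A B C A1 B1 C1,
        cast_eq_mx A1 (block_mx (1%:M : 'M_(j + i')) 0 0
          (epsmx (a : 'M_(m', (s + k') + n')))),
        cast_eq_mx B1 (block_mx (col_mx 1%:M 0 : 'M_(j + i', j)) (col_mx 0 (epsmx b)) 0
          (block_mx (1%:M : 'M_(s + k')) (epsmx c) 0 (epsmx (d : 'M_(n', t + p')))))
      & cast_eq_mx C1 (col_mx (epsmx (x : 'M_(j, s + (t + q'))))
          (col_mx (row_mx (col_mx 1%:M 0 : 'M_(s + k', s)) (row_mx 0 (epsmx y)))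
            (row_mx 0 (row_mx (col_mx 1%:M 0 : 'M_(t + p', t)) (epsmx z)))))].
Proof.
rewrite !stmxM => /quat_triple_form.
move=> [j [i' [m' [s [k' [n' [t [p' [q' [A0 [B0 [C0 [E EA EB EC]]]]]]]]]]]]].
have {E}[A1 [B1 [C1 E]]] := triple_equiv_lift E.
(* A cast equality carries the equations between the sizes; substituting them turns it into a plain
   equality. *)
have [[e1 e2] _] := EA; have [[_ e3] _] := EB; have [[_ e4] _] := EC.
subst m n p q; move: E; rewrite (cast_eq_mx_eq EA) (cast_eq_mx_eq EB) (cast_eq_mx_eq EC).
have [K [L [M [a [b [c [d [x [y [z [KS EA1 EB1 EC1]]]]]]]]]]] :=
  std_infinitesimal_reduction (quat_involution R) A1 B1 C1.
move/triple_equiv_trans/(_ (triple_equiv_infinitesimal _ _ _ _ _ _ L M KS)).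
rewrite EA1 EB1 EC1 => E.
exists j, i', m', s, k', n', t, p', q', a, b, c, d, x, y, z.
eexists; eexists; eexists; split; first exact: E.
- rewrite /std_A dmx_block !dmx0 dmx1 -epsmxE; exact: cast_eq_mx_refl.
- rewrite /std_B !dmx_block dmx0 dmx1 dmx_col0 dmx0 dmx1 -!epsmxE epsmx_col0 epsmx0.
  exact: cast_eq_mx_refl.
- have E1 : block_mx (1%:M : 'M[quat R]_s) 0 0 (0 : 'M_(k', t + q')) =
      row_mx (col_mx 1%:M 0) (row_mx 0 0) by rewrite block_mxEh col_mx0 row_mx0.
  have E2 : block_mx (1%:M : 'M[quat R]_t) 0 0 (0 : 'M_(p', q')) =
      row_mx (col_mx 1%:M 0) 0 by rewrite block_mxEh col_mx0.
  rewrite /std_C E1 E2 !dmx_col !dmx_row !dmx0 !dmx_col0 !dmx0 !dmx1 -!epsmxE ?epsmx0.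
  exact: cast_eq_mx_refl.
Qed.

(** * Equality of matrices up to a cast of the dimensions *)

Section CastEqMx.
Variable T : Type.

Lemma cast_eq_mx_sym m n m' n' (A : 'M[T]_(m, n)) (B : 'M[T]_(m', n')) :
  cast_eq_mx A B -> cast_eq_mx B A.
Proof.
move=> AB; have [[e1 e2] _] := AB; subst m n.
by rewrite (cast_eq_mx_eq AB); apply: cast_eq_mx_refl.
Qed.

Lemma cast_eq_mx_trans m n m' n' m'' n'' (B : 'M[T]_(m', n')) (A : 'M[T]_(m, n))
    (C : 'M[T]_(m'', n'')) : cast_eq_mx A B -> cast_eq_mx B C -> cast_eq_mx A C.
Proof. by move=> AB; have [[e1 e2] _] := AB; subst m n; rewrite (cast_eq_mx_eq AB). Qed.

Lemma cast_eq_col_mx m1 m2 n m1' m2' n' (A : 'M[T]_(m1, n)) (B : 'M[T]_(m2, n))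
    (A' : 'M[T]_(m1', n')) (B' : 'M[T]_(m2', n')) :
  cast_eq_mx A A' -> cast_eq_mx B B' -> cast_eq_mx (col_mx A B) (col_mx A' B').
Proof.
move=> AA BB; have [[e1 e2] _] := AA; have [[e3 _] _] := BB; subst m1 n m2.
by rewrite (cast_eq_mx_eq AA) (cast_eq_mx_eq BB); apply: cast_eq_mx_refl.
Qed.

Lemma cast_eq_col_mxA m1 m2 m3 n (A : 'M[T]_(m1, n)) (B : 'M[T]_(m2, n))
    (C : 'M[T]_(m3, n)) :
  cast_eq_mx (col_mx (col_mx A B) C) (col_mx A (col_mx B C)).
Proof.
by apply: cast_eq_mx_sym; exists (esym (addnA m1 m2 m3), erefl n); exact: col_mxA.
Qed.

Lemma cast_eq_row_mxA m n1 n2 n3 (A : 'M[T]_(m, n1)) (B : 'M[T]_(m, n2))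
    (C : 'M[T]_(m, n3)) :
  cast_eq_mx (row_mx (row_mx A B) C) (row_mx A (row_mx B C)).
Proof.
by apply: cast_eq_mx_sym; exists (erefl m, esym (addnA n1 n2 n3)); exact: row_mxA.
Qed.
End CastEqMx.

Section CastEqBlocks.
Variable T : nzRingType.

Lemma col_mx_row0l m1 m2 n1 n2 (A : 'M[T]_(m1, n2)) (B : 'M[T]_(m2, n2)) :
  row_mx (0 : 'M_(m1 + m2, n1)) (col_mx A B) = col_mx (row_mx 0 A) (row_mx 0 B).
Proof.
have -> : (0 : 'M[T]_(m1 + m2, n1)) = col_mx 0 0 by rewrite col_mx0.
by rewrite -block_mxEh block_mxEv.
Qed.

Lemma cast_eq_row_mx00 r j n m (Y : 'M[T]_(m, n)) :
  cast_eq_mx (row_mx (0 : 'M_(m, r)) (row_mx (0 : 'M_(m, j)) Y)) (row_mx (0 : 'M_(m, r + j)) Y).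
Proof.
have -> : (0 : 'M[T]_(m, r + j)) = row_mx 0 0 by rewrite row_mx0.
exact/cast_eq_mx_sym/cast_eq_row_mxA.
Qed.

Lemma cast_eq_mx_1block r j n :
  cast_eq_mx (col_mx (row_mx (1%:M : 'M[T]_r) 0) (row_mx 0 (row_mx (1%:M : 'M_j) (0 : 'M_(j, n)))))
    (row_mx (1%:M : 'M_(r + j)) (0 : 'M_(r + j, n))).
Proof.
have -> : row_mx (1%:M : 'M[T]_(r + j)) (0 : 'M_(r + j, n)) =
    col_mx (row_mx (row_mx 1%:M 0) 0) (row_mx (row_mx 0 1%:M) 0).
  rewrite (scalar_mx_block r j) [in LHS]block_mxEv.
  have -> : (0 : 'M[T]_(r + j, n)) = col_mx 0 0 by rewrite col_mx0.
  by rewrite -block_mxEh block_mxEv.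
apply: cast_eq_col_mx; last exact/cast_eq_mx_sym/cast_eq_row_mxA.
have -> : (0 : 'M[T]_(r, j + n)) = row_mx 0 0 by rewrite row_mx0.
exact/cast_eq_mx_sym/cast_eq_row_mxA.
Qed.

Lemma cast_eq_block_A r i m n (E : 'M[T]_(m, n)) :
  cast_eq_mx (block_mx (1%:M : 'M_r) 0 0 (block_mx (1%:M : 'M_i) 0 0 E))
    (block_mx (1%:M : 'M_(r + i)) 0 0 E).
Proof.
rewrite ![block_mx _ _ _ _]block_mxEv col_mx_row0l.
apply: cast_eq_mx_trans (cast_eq_mx_sym (cast_eq_col_mxA _ _ _)) _.
apply: cast_eq_col_mx; [exact: cast_eq_mx_1block | exact: cast_eq_row_mx00].
Qed.

Lemma cast_eq_block_B r j i k n p (b1 : 'M[T]_(i, k)) (b2 : 'M[T]_(i, p)) (c : 'M[T]_(k, p))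
    (d : 'M[T]_(n, p)) :
  cast_eq_mx (block_mx (1%:M : 'M_r) 0 0
      (block_mx (col_mx (1%:M : 'M_j) 0) (col_mx 0 (row_mx b1 b2)) 0 (block_mx 1%:M c 0 d)))
    (col_mx (row_mx (1%:M : 'M_(r + j)) (row_mx 0 0))
    (col_mx (row_mx 0 (row_mx b1 b2))
    (col_mx (row_mx 0 (row_mx 1%:M c)) (row_mx 0 (row_mx 0 d))))).
Proof.
rewrite row_mx0 block_mxEv [in row_mx 0 _]block_mxEv -[row_mx (col_mx _ _) _]block_mxEh.
rewrite [block_mx 1%:M 0 _ _]block_mxEv [block_mx 1%:M c _ _]block_mxEv !col_mx_row0l.
apply: cast_eq_mx_trans (cast_eq_col_mx (cast_eq_mx_refl _) (cast_eq_col_mxA _ _ _)) _.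
apply: cast_eq_mx_trans (cast_eq_mx_sym (cast_eq_col_mxA _ _ _)) _.
apply: cast_eq_col_mx; first exact: cast_eq_mx_1block.
by do 2?[apply: cast_eq_col_mx; first exact: cast_eq_row_mx00]; apply: cast_eq_row_mx00.
Qed.

(** Unlike the leading identities of [A] and [B], the block [S] stays separate, so only the last
    rows are regrouped. *)
Lemma cast_eq_block_C r j s k t p q (S : 'M[T]_r) (x1 : 'M[T]_(j, s)) (x2 : 'M[T]_(j, t))
    (x3 : 'M[T]_(j, q)) (y1 : 'M[T]_(s, q)) (y2 : 'M[T]_(k, q)) (z1 : 'M[T]_(t, q))
    (z2 : 'M[T]_(p, q)) :
  cast_eq_mx (block_mx S 0 0
      (col_mx (row_mx x1 (row_mx x2 x3))
        (col_mx (row_mx (col_mx 1%:M 0) (row_mx 0 (col_mx y1 y2)))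
                (row_mx 0 (row_mx (col_mx 1%:M 0) (col_mx z1 z2))))))
    (col_mx (row_mx S (row_mx 0 (row_mx 0 0)))
    (col_mx (row_mx 0 (row_mx x1 (row_mx x2 x3)))
    (col_mx (row_mx 0 (row_mx 1%:M (row_mx 0 y1)))
    (col_mx (row_mx 0 (row_mx 0 (row_mx 0 y2)))
    (col_mx (row_mx 0 (row_mx 0 (row_mx 1%:M z1)))
            (row_mx 0 (row_mx 0 (row_mx 0 z2)))))))).
Proof.
have -> : row_mx (col_mx 1%:M 0) (row_mx 0 (col_mx y1 y2)) =
    col_mx (row_mx (1%:M : 'M_s) (row_mx (0 : 'M_(s, t)) y1)) (row_mx 0 (row_mx 0 y2)).
  by rewrite col_mx_row0l -block_mxEh block_mxEv.
have -> : row_mx (col_mx 1%:M 0) (col_mx z1 z2) =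
    col_mx (row_mx (1%:M : 'M_t) z1) (row_mx 0 z2) by rewrite -block_mxEh block_mxEv.
rewrite !row_mx0 block_mxEv !col_mx_row0l.
apply: cast_eq_col_mx (cast_eq_mx_refl _) _; apply: cast_eq_col_mx (cast_eq_mx_refl _) _.
exact: cast_eq_col_mxA.
Qed.
End CastEqBlocks.

(** * Splitting off the appreciable singular values *)

Lemma sigma_mx_inverse (R : realType) (s : seq (dualnum R)) :
  all (@appreciable R) s -> exists S', is_inverse (sigma_mx s) S'.
Proof.
move=> s0; pose inv (x : dualnum R) :=
  Dual (stpart x)^-1 (- (inpart x / (stpart x * stpart x))).
have invP x : stpart x != 0 -> x * inv x = 1 /\ inv x * x = 1.
  by move=> x0; split; congr Dual; rewrite /=; field.
have s1 (b : 'I_(size s)) : stpart (nth 0 s b) != 0.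
  exact: allP s0 _ (mem_nth 0 (ltn_ord b)).
exists (diag_mx (\row_b dq_of_dual (inv (nth 0 s b)))); split;
  rewrite mulmx_diag -diag_const_mx; congr diag_mx; apply/rowP => b;
  rewrite [RHS]mxE mxE [X in X * _]mxE [X in _ * X]mxE -dq_of_dualM.
- by rewrite (invP _ (s1 b)).1.
- by rewrite (invP _ (s1 b)).2.
Qed.

Lemma appreciable_split (R : realType) m n p q (A : 'M[dualquat R]_(m, n))
    (B : 'M[dualquat R]_(n, p)) (C : 'M[dualquat R]_(p, q)) ap im :
  is_singular_values (A *m B *m C) ap im ->
  exists m' n' p' q' (A' : 'M[dualquat R]_(m', n')) (B' : 'M[dualquat R]_(n', p'))
      (C' : 'M[dualquat R]_(p', q')) A1 B1 C1,
    [/\ triple_equiv (dq_involution R) A B C A1 B1 C1,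
        cast_eq_mx A1 (block_mx (1%:M : 'M_(size ap)) 0 0 A'),
        cast_eq_mx B1 (block_mx (1%:M : 'M_(size ap)) 0 0 B'),
        cast_eq_mx C1 (block_mx (sigma_mx ap) 0 0 C')
      & stmx (A' *m B' *m C') = 0].
Proof.
move=> [/andP[ap0 _] /andP[im0 _] sz [U [V [UU VU E]]]].
move: sz; rewrite leq_min => /andP[sm sn].
have {E} : dqstar U *m (A *m B *m C) *m V = rect_diag m q (ap ++ im).
  by case: E => e ->; apply: rect_diag_cast.
rewrite size_cat in sm sn.
have [m' mE] := subnKC_ex (leq_trans (leq_addr _ _) sm).
have [q' qE] := subnKC_ex (leq_trans (leq_addr _ _) sn).
move=> {sm sn}; subst m q; rewrite rect_diag_cat.
have [A1 [A2 AE]] : exists A1 A2, dqstar U *m A = col_mx A1 A2.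
  by exists (usubmx (dqstar U *m A)), (dsubmx (dqstar U *m A)); rewrite vsubmxK.
have [C1 [C2 CE]] : exists C1 C2, C *m V = row_mx C1 C2.
  by exists (lsubmx (C *m V)), (rsubmx (C *m V)); rewrite hsubmxK.
rewrite -!mulmxA CE !mulmxA AE mul_col_mx mul_col_row => /eq_block_mx[E11 E12 E21 E22].
have [|S' SS'] := @sigma_mx_inverse R ap.
  by apply: sub_all ap0 => x /andP[].
have AX : A1 *m (B *m (C1 *m S')) = 1%:M.
  by rewrite !mulmxA E11; exact: SS'.1.
have AY : (A1 *m B) *m (C1 *m S') = 1%:M by rewrite -mulmxA.
have [n' [X' [F' [nE P1 P2]]]] := dual_completion AX.
have [p' [Y' [G' [pE Q1 Q2]]]] := dual_completion AY.
subst n p.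
have [H1 H2 H3 H4] := split_off_invertible SS' E11 E12 E21 P1 P2 Q1 Q2.
exists m', n', p', q', (A2 *m X'), (F' *m B *m Y'), (G' *m C2).
eexists; eexists; eexists; split.
- exists U, V, (row_mx (B *m (C1 *m S')) X'), (col_mx A1 F').
  exists (row_mx (C1 *m S') Y'), (col_mx (A1 *m B) G').
  split; [exact: UU | exact: VU | exact: (conj P2 P1) | exact: (conj Q2 Q1) | ].
  split; [rewrite AE; exact: H1 | exact: H2 | rewrite -mulmxA CE; exact: H3].
- exact: cast_eq_mx_refl.
- exact: cast_eq_mx_refl.
- exact: cast_eq_mx_refl.
(* The remaining product is the lower right block of the SVD of [A B C], whose diagonal lists the
   infinitesimal singular values followed by zeros. *)
rewrite H4 E22; apply/matrixP => a b; rewrite !mxE.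
case: ifP => // _; have [a_lt|/(nth_default 0)->//] := ltnP a (size im).
by have /andP[/eqP] := allP im0 _ (mem_nth 0 a_lt) => /= ->.
Qed.

(* The block sizes are free variables constrained by equations, so that they can
   later be replaced by the truncated differences of the main statement. *)
Lemma triple_form (R : realType) m n p q (A : 'M[dualquat R]_(m, n))
    (B : 'M[dualquat R]_(n, p)) (C : 'M[dualquat R]_(p, q)) ap im :
  is_singular_values (A *m B *m C) ap im ->
  exists (i j k s t m' n' i' p' n'' j' q' k' p'' : nat),
    [/\ (i + m' = m)%N, (i + n' = n)%N, (j + i' = i)%N, (j + k + p' = p)%N &
        (i + k + n'' = n)%N] /\
    [/\ (size ap + j' = j)%N, (size ap + s + t + q' = q)%N, (s + k' = k)%N &
        (j + k + t + p'' = p)%N] /\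
    exists (A22 : 'M[quat R]_(m', n')) (B12h : 'M[quat R]_(i', k)) (B13h : 'M[quat R]_(i', p'))
       (B23 : 'M[quat R]_(k, p')) (B23h : 'M[quat R]_(n'', p'))
       (C12h : 'M[quat R]_(j', s)) (C13h : 'M[quat R]_(j', t)) (C14h : 'M[quat R]_(j', q'))
       (C24 : 'M[quat R]_(s, q')) (C24h : 'M[quat R]_(k', q'))
       (C34 : 'M[quat R]_(t, q')) (C34h : 'M[quat R]_(p'', q')) A1 B1 C1,
    [/\ triple_equiv (dq_involution R) A B C A1 B1 C1,
        cast_eq_mx A1 (block_mx (1%:M : 'M_i) 0 0 (epsmx A22)),
        cast_eq_mx B1
          (col_mx (row_mx (1%:M : 'M_j) (row_mx 0 0))
          (col_mx (row_mx 0 (row_mx (epsmx B12h) (epsmx B13h)))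
          (col_mx (row_mx 0 (row_mx 1%:M (epsmx B23)))
                  (row_mx 0 (row_mx 0 (epsmx B23h))))))
      & cast_eq_mx C1
          (col_mx (row_mx (sigma_mx ap) (row_mx 0 (row_mx 0 0)))
          (col_mx (row_mx 0 (row_mx (epsmx C12h) (row_mx (epsmx C13h) (epsmx C14h))))
          (col_mx (row_mx 0 (row_mx 1%:M (row_mx 0 (epsmx C24))))
          (col_mx (row_mx 0 (row_mx 0 (row_mx 0 (epsmx C24h))))
          (col_mx (row_mx 0 (row_mx 0 (row_mx 1%:M (epsmx C34))))
                  (row_mx 0 (row_mx 0 (row_mx 0 (epsmx C34h)))))))))].
Proof.
move=> /appreciable_split[m0 [n0 [p0 [q0 [A' [B' [C' [A1 [B1 [C1 [E EA EB EC prod0]]]]]]]]]]].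
have [j0 [i' [m' [s [k' [n' [t [p' [q' [a [b [c [d [x [y [z [A2 [B2 [C2]]]]]]]]]]]]]]]]]]] :=
  infinitesimal_triple_form prod0.
case=> E2 EA2 EB2 EC2; set r := size ap in EA EB EC *.
have [[e1 e2] _] := EA2; have [[_ e3] _] := EB2; have [[_ e4] _] := EC2.
subst m0 n0 p0 q0.
have [[e1 e2] _] := EA; have [[_ e3] _] := EB; have [[_ e4] _] := EC; subst m n p q.
move: E2 E; rewrite (cast_eq_mx_eq EA2) (cast_eq_mx_eq EB2) (cast_eq_mx_eq EC2).
rewrite (cast_eq_mx_eq EA) (cast_eq_mx_eq EB) (cast_eq_mx_eq EC).
move=> /(triple_equiv_block (sigma_mx ap)) E2 E.
have {E2 E EA EB EC EA2 EB2 EC2} E3 := triple_equiv_trans E E2.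
(* The identity split off first enlarges the leading identities of [A] and [B] by [r], while [j0]
   itself becomes the height [j - r] in [C]. *)
exists (r + (j0 + i'))%N, (r + j0)%N, (s + k')%N, s, t, m', (s + k' + n')%N, i', (t + p')%N, n'.
exists j0, q', k', p'; split; first by split; rewrite ?addnA.
split; first by split; rewrite ?addnA.
exists a, (lsubmx b), (rsubmx b), c, d, (lsubmx x), (lsubmx (rsubmx x)), (rsubmx (rsubmx x)).
exists (usubmx y), (dsubmx y), (usubmx z), (dsubmx z).
eexists; eexists; eexists; split; first exact: E3.
- exact: cast_eq_block_A.
- have -> : epsmx b = row_mx (epsmx (lsubmx b)) (epsmx (rsubmx b)).
    by rewrite !epsmxE -dmx_row row_mx0 hsubmxK.
  exact: cast_eq_block_B.
have -> : epsmx x = row_mx (epsmx (lsubmx x)) (row_mx (epsmx (lsubmx (rsubmx x))) (epsmx (rsubmx (rsubmx x)))).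
  by rewrite !epsmxE -!dmx_row !row_mx0 !hsubmxK.
have -> : epsmx y = col_mx (epsmx (usubmx y)) (epsmx (dsubmx y)).
  by rewrite !epsmxE -dmx_col col_mx0 vsubmxK.
have -> : epsmx z = col_mx (epsmx (usubmx z)) (epsmx (dsubmx z)).
  by rewrite !epsmxE -dmx_col col_mx0 vsubmxK.
exact: cast_eq_block_C.
Qed.
Theorem theorem5p1 (R : realType) (m n p q : nat)
    (A : 'M[dualquat R]_(m, n)) (B : 'M[dualquat R]_(n, p))
    (C : 'M[dualquat R]_(p, q)) :
  let delta := appreciable_singular_values (A *m B *m C) in
  let r := Arank (A *m B *m C) in
  exists (U : 'M[dualquat R]_m) (V : 'M[dualquat R]_q)
         (P P' : 'M[dualquat R]_n) (Q Q' : 'M[dualquat R]_p)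
         (i j k s t : nat)
         (A22 : 'M[quat R]_(m - i, n - i))
         (B12h : 'M[quat R]_(i - j, k)) (B13h : 'M[quat R]_(i - j, p - j - k))
         (B23 : 'M[quat R]_(k, p - j - k))
         (B23h : 'M[quat R]_(n - i - k, p - j - k))
         (C12h : 'M[quat R]_(j - r, s)) (C13h : 'M[quat R]_(j - r, t))
         (C14h : 'M[quat R]_(j - r, q - r - s - t))
         (C21 : 'M[quat R]_(s, r)) (C24 : 'M[quat R]_(s, q - r - s - t))
         (C24h : 'M[quat R]_(k - s, q - r - s - t))
         (C31 : 'M[quat R]_(t, r)) (C34 : 'M[quat R]_(t, q - r - s - t))
         (C34h : 'M[quat R]_(p - j - k - t, q - r - s - t)),
    [/\ [/\ unitary_dq U, unitary_dq V, is_inverse P P' & is_inverse Q Q'],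
        [/\ [/\ r <= j, j <= i & i <= m],
            [/\ i + k <= n, j + k + t <= p & s <= k]
          & r + s + t <= q]%N,
        [/\ sorted (@dual_ge R) delta,
            all (fun d => dual_gt d 0) delta & all (@appreciable R) delta]
      & [/\ cast_eq_mx (ctmx U *m A *m P)
              (block_mx (1%:M : 'M_i) 0
                        0             (epsmx A22)),
            cast_eq_mx (P' *m B *m Q)
              (col_mx (row_mx (1%:M : 'M_j) (row_mx 0            0))
              (col_mx (row_mx 0             (row_mx (epsmx B12h) (epsmx B13h)))
              (col_mx (row_mx 0             (row_mx 1%:M         (epsmx B23)))
                      (row_mx 0             (row_mx 0            (epsmx B23h))))))
          & cast_eq_mx (Q' *m C *m V)
              (col_mx (row_mx (sigma_mx delta)
                        (row_mx 0            (row_mx 0            0)))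
              (col_mx (row_mx 0
                        (row_mx (epsmx C12h) (row_mx (epsmx C13h) (epsmx C14h))))
              (col_mx (row_mx (epsmx C21)
                        (row_mx 1%:M         (row_mx 0            (epsmx C24))))
              (col_mx (row_mx (0 : 'M_(k - s, r))
                        (row_mx 0            (row_mx 0            (epsmx C24h))))
              (col_mx (row_mx (epsmx C31)
                        (row_mx 0            (row_mx 1%:M         (epsmx C34))))
                      (row_mx 0
                        (row_mx 0            (row_mx 0            (epsmx C34h)))))))))]].
Proof.
move=> delta; rewrite /Arank -/delta /=.
(* The SVD shows that the set from which [xget] chooses is inhabited, so its choice does consist of
   singular values. *)
have [im SV] : exists im, is_singular_values (A *m B *m C) delta im.
  exists (singular_values (A *m B *m C)).2; apply: (@xgetPex _ ([::], [::])
    [set s | is_singular_values (A *m B *m C) s.1 s.2]%classic).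
  by have [ap [im SV]] := dual_svd (A *m B *m C); exists (ap, im).
move: delta SV => delta SV.
case: (SV) => /andP[delta0 delta_sorted] _ _ _.
have [i [j [k [s [t [m' [n' [i' [p' [n'' [j' [q' [k' [p'']]]]]]]]]]]]]] := triple_form SV.
case=> [[e1 e2 e3 e4 e5] [[e6 e7 e8 e9]]].
have le_j : (size delta <= j)%N by rewrite -e6 leq_addr.
have le_i : (j <= i)%N by rewrite -e3 leq_addr.
have le_m : (i <= m)%N by rewrite -e1 leq_addr.
have le_n : (i + k <= n)%N by rewrite -e5 leq_addr.
have le_p : (j + k + t <= p)%N by rewrite -e9 leq_addr.
have le_k : (s <= k)%N by rewrite -e8 leq_addr.
have le_q : (size delta + s + t <= q)%N by rewrite -e7 leq_addr.
have ? : m' = (m - i)%N by rewrite -e1 addKn.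
have ? : n' = (n - i)%N by rewrite -e2 addKn.
have ? : i' = (i - j)%N by rewrite -e3 addKn.
have ? : p' = (p - j - k)%N by rewrite -e4 -!addnA !addKn.
have ? : n'' = (n - i - k)%N by rewrite -e5 -!addnA !addKn.
have ? : j' = (j - size delta)%N by rewrite -e6 addKn.
have ? : q' = (q - size delta - s - t)%N by rewrite -e7 -!addnA !addKn.
have ? : k' = (k - s)%N by rewrite -e8 addKn.
have ? : p'' = (p - j - k - t)%N by rewrite -e9 -!addnA !addKn.
subst m' n' i' p' n'' j' q' k' p''.
move=> [A22 [B12h [B13h [B23 [B23h [C12h [C13h [C14h [C24 [C24h [C34 [C34h [A1 [B1 [C1]]]]]]]]]]]]]]].
case=> [[U [V [P [P' [Q [Q' [UU VV PP QQ [<- <- <-]]]]]]]] EA EB EC].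
exists U, V, P, P', Q, Q', i, j, k, s, t, A22, B12h, B13h, B23, B23h, C12h, C13h, C14h.
(* The two zeros are [C21] and [C31]: splitting off [Sigma] leaves nothing below it. *)
exists 0, C24, C24h, 0, C34, C34h; split.
(* [unitary_dq] and [ctmx] are convertible to [unitary] and [star] at [dq_involution]. *)
- by split; [exact: UU | exact: VV | exact: PP | exact: QQ].
- by split.
- split; first exact: delta_sorted.
    by apply: sub_all delta0 => x /andP[].
  by apply: sub_all delta0 => x /andP[].
- by split; [exact: EA | exact: EB | rewrite !epsmx0; exact: EC].
Qed.
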